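(* Let $\mathbf{L}$ be one of the logics described in the context. The following two cut rules are admissible in $\mathbf{G3Q\lambda.L}$ (i.e. whenever both premisses are derivable, so is the conclusion): $Cut$: from $\Gamma\Rightarrow\Delta,w:A$ and $w:A,\Gamma'\Rightarrow\Delta'$ infer $\Gamma',\Gamma\Rightarrow\Delta,\Delta'$ (for any $\mathcal{L}^\lambda$-formula $A$ and label $w$); $Cut'$: from $\Gamma\Rightarrow\Delta,D(t,x,w)$ and $D(t,x,w),\Gamma'\Rightarrow\Delta'$ infer $\Gamma',\Gamma\Rightarrow\Delta,\Delta'$ (for any term $t$, variable $x$, label $w$).
   Context: Language $\mathcal{L}^\lambda$: fix a signature of $n$-ary predicate letters and an infinite set of variables $x,y,z,\dots$. Terms and formulas are defined simultaneously: terms $t::=x\mid \iota xA$ (definite descriptions), formulas $A::=Px_1\dots x_n\mid x_1=x_2\mid\bot\mid A\wedge A\mid A\vee A\mid A\supset A\mid\forall xA\mid\exists xA\mid\Box A\mid\Diamond A\mid \lambda xA.t$. $\iota x$ binds $x$ in $A$; in $\lambda xA.t$ the occurrences of $x$ in $A$ are bound by $\lambda x$ (the displayed $t$ is not in its scope). $A[y/x]$ replaces free occurrences of $x$ by $y$, with $y$ free for $x$. Atomic formulas are $Px_1\dots x_n$ and $x_1=x_2$. Labelled sequents. Labels $w,v,u,\dots$ form a separate set. Expressions: labelled formulas $w:A$, domain atoms $x\in w$, relational atoms $w\mathscr{R}v$, denotation formulas $D(t,x,w)$ ($t$ a term, $x$ a variable). A sequent $\Gamma\Rightarrow\Delta$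 has $\Gamma$ a multiset of labelled formulas, denotation formulas, domain atoms and relational atoms, and $\Delta$ a multiset of labelled formulas and denotation formulas. Substitutions $[y/x]$, $[w/v]$ extend componentwise. ''Fresh'' means not occurring in the conclusion of the rule. Calculus $\mathbf{G3Q\lambda.K}$. Initial sequents: $w:p,\Gamma\Rightarrow\Delta,w:p$ ($p$ atomic); $D(y,x,w),\Gamma\Rightarrow\Delta,D(y,x,w)$ ($y$ a variable); $w:\bot,\Gamma\Rightarrow\Delta$. Propositional rules (at one label $w$): $L\wedge$: from $w:A,w:B,\Gamma\Rightarrow\Delta$ infer $w:A\wedge B,\Gamma\Rightarrow\Delta$; $R\wedge$: from $\Gamma\Rightarrow\Delta,w:A$ and $\Gamma\Rightarrow\Delta,w:B$ infer $\Gamma\Rightarrow\Delta,w:A\wedge B$; $L\vee$: from $w:A,\Gamma\Rightarrow\Delta$ and $w:B,\Gamma\Rightarrow\Delta$ infer $w:A\vee B,\Gamma\Rightarrow\Delta$; $R\vee$: from $\Gamma\Rightarrow\Delta,w:A,w:B$ infer $\Gamma\Rightarrow\Delta,w:A\vee B$; $L\supset$: from $\Gamma\Rightarrow\Delta,w:A$ and $w:B,\Gamma\Rightarrow\Delta$ infer $w:A\supset B,\Gamma\Rightarrow\Delta$; $R\supset$: from $w:A,\Gamma\Rightarrow\Delta,w:B$ infer $\Gamma\Rightarrow\Delta,w:A\supset B$. Quantifiers: $L\forall$: from $w:A[y/x],y\in w,w:\forall xA,\Gamma\Rightarrow\Delta$ infer $y\in w,w:\forall xA,\Gamma\Rightarrow\Delta$;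 $R\forall$ ($z$ fresh): from $z\in w,\Gamma\Rightarrow\Delta,w:A[z/x]$ infer $\Gamma\Rightarrow\Delta,w:\forall xA$; $L\exists$ ($z$ fresh): from $z\in w,w:A[z/x],\Gamma\Rightarrow\Delta$ infer $w:\exists xA,\Gamma\Rightarrow\Delta$; $R\exists$: from $y\in w,\Gamma\Rightarrow\Delta,w:\exists xA,w:A[y/x]$ infer $y\in w,\Gamma\Rightarrow\Delta,w:\exists xA$. Modalities: $L\Box$: from $v:A,w\mathscr{R}v,w:\Box A,\Gamma\Rightarrow\Delta$ infer $w\mathscr{R}v,w:\Box A,\Gamma\Rightarrow\Delta$; $R\Box$ ($u$ fresh): from $w\mathscr{R}u,\Gamma\Rightarrow\Delta,u:A$ infer $\Gamma\Rightarrow\Delta,w:\Box A$; $L\Diamond$ ($u$ fresh): from $w\mathscr{R}u,u:A,\Gamma\Rightarrow\Delta$ infer $w:\Diamond A,\Gamma\Rightarrow\Delta$; $R\Diamond$: from $w\mathscr{R}v,\Gamma\Rightarrow\Delta,w:\Diamond A,v:A$ infer $w\mathscr{R}v,\Gamma\Rightarrow\Delta,w:\Diamond A$. Identity: $Ref_=$: from $w:x=x,\Gamma\Rightarrow\Delta$ infer $\Gamma\Rightarrow\Delta$; $RigVar$: from $v:y=z,w:y=z,\Gamma\Rightarrow\Delta$ infer $w:y=z,\Gamma\Rightarrow\Delta$; $Repl$: from $E[z/x],E[y/x],w:y=z,\Gamma\Rightarrow\Delta$ infer $E[y/x],w:y=z,\Gamma\Rightarrow\Delta$, where $E$ is a denotation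 formula with variable first argument and label $w$, a domain atom $x'\in w$, or a labelled atomic formula $w:p$. $\lambda$: $L\lambda$ ($z$ fresh): from $D(t,z,w),w:B[z/x],\Gamma\Rightarrow\Delta$ infer $w:\lambda xB.t,\Gamma\Rightarrow\Delta$; $R\lambda$: from $\Gamma\Rightarrow\Delta,w:\lambda xB.t,D(t,y,w)$ and $\Gamma\Rightarrow\Delta,w:\lambda xB.t,w:B[y/x]$ infer $\Gamma\Rightarrow\Delta,w:\lambda xB.t$. Denotation: $LD_1$: from $w:A[x_2/x_1],D(\iota x_1A,x_2,w),\Gamma\Rightarrow\Delta$ infer $D(\iota x_1A,x_2,w),\Gamma\Rightarrow\Delta$; $LD_2$: from $D(\iota x_1A,x_2,w),\Gamma\Rightarrow\Delta,w:A[y/x_1]$ and $w:x_2=y,D(\iota x_1A,x_2,w),\Gamma\Rightarrow\Delta$ infer $D(\iota x_1A,x_2,w),\Gamma\Rightarrow\Delta$; $RD$ ($z$ fresh): from $\Gamma\Rightarrow\Delta,w:A[x_2/x_1]$ and $w:A[z/x_1],\Gamma\Rightarrow\Delta,w:x_2=z$ infer $\Gamma\Rightarrow\Delta,D(\iota x_1A,x_2,w)$; $DenVar$: from $D(x,x,w),\Gamma\Rightarrow\Delta$ infer $\Gamma\Rightarrow\Delta$; $DenId$: from $w:y=x,D(y,x,w),\Gamma\Rightarrow\Delta$ infer $D(y,x,w),\Gamma\Rightarrow\Delta$ ($x,y$ variables). Non-logical rules: $Ref_\mathcal{W}$: from $w\mathscr{R}w,\Gamma\Rightarrow\Delta$ infer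 $\Gamma\Rightarrow\Delta$; $Ser$ ($u$ fresh): from $w\mathscr{R}u,\Gamma\Rightarrow\Delta$ infer $\Gamma\Rightarrow\Delta$; $Trans$: from $w\mathscr{R}u,w\mathscr{R}v,v\mathscr{R}u,\Gamma\Rightarrow\Delta$ infer $w\mathscr{R}v,v\mathscr{R}u,\Gamma\Rightarrow\Delta$; $Eucl$: from $v\mathscr{R}u,w\mathscr{R}v,w\mathscr{R}u,\Gamma\Rightarrow\Delta$ infer $w\mathscr{R}v,w\mathscr{R}u,\Gamma\Rightarrow\Delta$, always together with $Eucl^c$: from $v\mathscr{R}v,w\mathscr{R}v,\Gamma\Rightarrow\Delta$ infer $w\mathscr{R}v,\Gamma\Rightarrow\Delta$; $Incr$: from $x\in v,x\in w,w\mathscr{R}v,\Gamma\Rightarrow\Delta$ infer $x\in w,w\mathscr{R}v,\Gamma\Rightarrow\Delta$; $Decr$: from $x\in w,x\in v,w\mathscr{R}v,\Gamma\Rightarrow\Delta$ infer $x\in v,w\mathscr{R}v,\Gamma\Rightarrow\Delta$; $Cons$: from $x\in w,\Gamma\Rightarrow\Delta$ infer $\Gamma\Rightarrow\Delta$. For any set $N$ of these non-logical rules, $\mathbf{G3Q\lambda.L}=\mathbf{G3Q\lambda.K}+N$. Derivations: trees of (pure: no variable both free and bound) sequents with initial sequents at the leaves, built by the rules; $\Gamma\Rightarrow\Delta$ is derivable if it or an alphabetic variant has a derivation. *)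

(* Defs.v *)
From mathcomp Require Import all_boot.
From Stdlib Require Import Permutation.
Set Implicit Arguments.
Unset Strict Implicit.
Unset Printing Implicit Defensive.

Record signature := Signature { letter : Type; arity : letter -> nat }.

Definition infinite (T : eqType) : Prop := forall s : seq T, exists x, x \notin s.

(* The language, with named variables; [Iota x A] is the definite description
   "the x such that A" and [Lam x A t] is "lambda x A . t", where x does not
   bind in t. *)
Inductive term (Sg : signature) (V : eqType) : Type :=
| TVar of V
| Iota of V & form Sg V
with form (Sg : signature) (V : eqType) : Type :=
| Atom (P : letter Sg) of (arity P).-tuple V
| Equ of V & V
| Bot
| And of form Sg V & form Sg V
| Or of form Sg V & form Sg V
| Imp of form Sg V & form Sg V
| All of V & form Sg V
| Ex of V & form Sg V
| Box of form Sg V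
| Dia of form Sg V
| Lam of V & form Sg V & term Sg V.

Arguments TVar {Sg V}.
Arguments Iota {Sg V}.
Arguments Atom {Sg V}.
Arguments Equ {Sg V}.
Arguments Bot {Sg V}.
Arguments And {Sg V}.
Arguments Or {Sg V}.
Arguments Imp {Sg V}.
Arguments All {Sg V}.
Arguments Ex {Sg V}.
Arguments Box {Sg V}.
Arguments Dia {Sg V}.
Arguments Lam {Sg V}.

Definition is_atom (Sg : signature) (V : eqType) (A : form Sg V) : bool :=
  match A with Atom _ _ | Equ _ _ => true | _ => false end.

Fixpoint fv_term (Sg : signature) (V : eqType) (t : term Sg V) : seq V :=
  match t with
  | TVar x => [:: x]
  | Iota x A => [seq z <- fv_form A | z != x]
  end
with fv_form (Sg : signature) (V : eqType) (A : form Sg V) : seq V :=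
  match A with
  | Atom _ xs => xs
  | Equ x y => [:: x; y]
  | Bot => [::]
  | And A B | Or A B | Imp A B => fv_form A ++ fv_form B
  | All x A | Ex x A => [seq z <- fv_form A | z != x]
  | Box A | Dia A => fv_form A
  | Lam x A t => [seq z <- fv_form A | z != x] ++ fv_term t
  end.

(* Bound variables; the variable of a vacuous binder counts as bound. *)
Fixpoint bv_term (Sg : signature) (V : eqType) (t : term Sg V) : seq V :=
  match t with
  | TVar _ => [::]
  | Iota x A => x :: bv_form A
  end
with bv_form (Sg : signature) (V : eqType) (A : form Sg V) : seq V :=
  match A with
  | Atom _ _ | Equ _ _ | Bot => [::]
  | And A B | Or A B | Imp A B => bv_form A ++ bv_form B
  | All x A | Ex x A => x :: bv_form A
  | Box A | Dia A => bv_form A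
  | Lam x A t => x :: bv_form A ++ bv_term t
  end.

Definition subst_var (V : eqType) (y x z : V) : V := if z == x then y else z.

(* Literal replacement of the free occurrences of x by y. It does not rename
   binders: capture is excluded by the separate condition [free_for]. *)
Fixpoint subst_term (Sg : signature) (V : eqType) (y x : V) (t : term Sg V) : term Sg V :=
  match t with
  | TVar z => TVar (subst_var y x z)
  | Iota z A => Iota z (if z == x then A else subst_form y x A)
  end
with subst_form (Sg : signature) (V : eqType) (y x : V) (A : form Sg V) : form Sg V :=
  match A with
  | Atom P zs => Atom P (map_tuple (subst_var y x) zs)
  | Equ z1 z2 => Equ (subst_var y x z1) (subst_var y x z2)
  | Bot => Bot
  | And A B => And (subst_form y x A) (subst_form y x B)
  | Or A B => Or (subst_form y x A) (subst_form y x B)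
  | Imp A B => Imp (subst_form y x A) (subst_form y x B)
  | All z A => All z (if z == x then A else subst_form y x A)
  | Ex z A => Ex z (if z == x then A else subst_form y x A)
  | Box A => Box (subst_form y x A)
  | Dia A => Dia (subst_form y x A)
  | Lam z A t => Lam z (if z == x then A else subst_form y x A) (subst_term y x t)
  end.

Notation "A <[ x := y ]>" := (subst_form y x A)
  (at level 2, left associativity, format "A <[ x  :=  y ]>").

(* y is free for x: no free occurrence of x lies in the scope of a binder of y. *)
Fixpoint free_for_term (Sg : signature) (V : eqType) (y x : V) (t : term Sg V) : bool :=
  match t with
  | TVar _ => true
  | Iota z A => (z == x) || ((z != y) || (x \notin fv_form A)) && free_for y x A
  end
with free_for (Sg : signature) (V : eqType) (y x : V) (A : form Sg V) : bool :=
  match A with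
  | Atom _ _ | Equ _ _ | Bot => true
  | And A B | Or A B | Imp A B => free_for y x A && free_for y x B
  | All z A | Ex z A =>
      (z == x) || ((z != y) || (x \notin fv_form A)) && free_for y x A
  | Box A | Dia A => free_for y x A
  | Lam z A t =>
      ((z == x) || ((z != y) || (x \notin fv_form A)) && free_for y x A)
      && free_for_term y x t
  end.

(* Alphabetic variants. The list e records the pairs of binders crossed so far,
   innermost first; at top level it is empty, so that free variables must agree. *)
Fixpoint alpha_var (V : eqType) (e : seq (V * V)) (x y : V) : bool :=
  match e with
  | [::] => x == y
  | (a, b) :: e' => ((x == a) && (y == b)) || [&& x != a, y != b & alpha_var e' x y]
  end.

Inductive alpha_term (Sg : signature) (V : eqType) (e : seq (V * V)) :
    term Sg V -> term Sg V -> Prop :=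
| alpha_TVar x y : alpha_var e x y -> alpha_term e (TVar x) (TVar y)
| alpha_Iota x y A B : alpha_form ((x, y) :: e) A B -> alpha_term e (Iota x A) (Iota y B)
with alpha_form (Sg : signature) (V : eqType) (e : seq (V * V)) :
    form Sg V -> form Sg V -> Prop :=
| alpha_Atom (P : letter Sg) (xs ys : (arity P).-tuple V) :
    (forall i, alpha_var e (tnth xs i) (tnth ys i)) -> alpha_form e (Atom P xs) (Atom P ys)
| alpha_Equ x1 x2 y1 y2 :
    alpha_var e x1 y1 -> alpha_var e x2 y2 -> alpha_form e (Equ x1 x2) (Equ y1 y2)
| alpha_Bot : alpha_form e Bot Bot
| alpha_And A A' B B' :
    alpha_form e A A' -> alpha_form e B B' -> alpha_form e (And A B) (And A' B')
| alpha_Or A A' B B' :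
    alpha_form e A A' -> alpha_form e B B' -> alpha_form e (Or A B) (Or A' B')
| alpha_Imp A A' B B' :
    alpha_form e A A' -> alpha_form e B B' -> alpha_form e (Imp A B) (Imp A' B')
| alpha_All x y A B : alpha_form ((x, y) :: e) A B -> alpha_form e (All x A) (All y B)
| alpha_Ex x y A B : alpha_form ((x, y) :: e) A B -> alpha_form e (Ex x A) (Ex y B)
| alpha_Box A B : alpha_form e A B -> alpha_form e (Box A) (Box B)
| alpha_Dia A B : alpha_form e A B -> alpha_form e (Dia A) (Dia B)
| alpha_Lam x y A B t s :
    alpha_form ((x, y) :: e) A B -> alpha_term e t s ->
    alpha_form e (Lam x A t) (Lam y B s).

(* [sexpr]: expressions allowed in succedents, i.e. w : A and D(t,x,w).
   [expr]: expressions allowed in antecedents. *)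
Inductive sexpr (Sg : signature) (V L : eqType) : Type :=
| Lab of L & form Sg V
| Den of term Sg V & V & L.

Inductive expr (Sg : signature) (V L : eqType) : Type :=
| Sx of sexpr Sg V L
| Dom of V & L
| Rel of L & L.

Arguments Lab {Sg V L}.
Arguments Den {Sg V L}.
Arguments Sx {Sg V L}.
Arguments Dom {Sg V L}.
Arguments Rel {Sg V L}.
Coercion Sx : sexpr >-> expr.

(* Lists stand for multisets: derivations are closed under [seq_equiv] below. *)
Record sequent (Sg : signature) (V L : eqType) : Type :=
  Sequent { ante : seq (expr Sg V L); succ : seq (sexpr Sg V L) }.

Notation "G ⇒ D" := (Sequent G D) (at level 80, no associativity).

Section Sequents.
Context {Sg : signature} {V L : eqType}.
Implicit Types (S : sequent Sg V L).

Definition fv_sexpr (E : sexpr Sg V L) : seq V :=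
  match E with Lab _ A => fv_form A | Den t x _ => x :: fv_term t end.
Definition bv_sexpr (E : sexpr Sg V L) : seq V :=
  match E with Lab _ A => bv_form A | Den t _ _ => bv_term t end.
Definition labels_sexpr (E : sexpr Sg V L) : seq L :=
  match E with Lab w _ => [:: w] | Den _ _ w => [:: w] end.

Definition fv_expr (E : expr Sg V L) : seq V :=
  match E with Sx F => fv_sexpr F | Dom x _ => [:: x] | Rel _ _ => [::] end.
Definition bv_expr (E : expr Sg V L) : seq V :=
  match E with Sx F => bv_sexpr F | Dom _ _ | Rel _ _ => [::] end.
Definition labels_expr (E : expr Sg V L) : seq L :=
  match E with Sx F => labels_sexpr F | Dom _ w => [:: w] | Rel w v => [:: w; v] end.

Definition fv_seq S : seq V :=
  flatten (map fv_expr (ante S)) ++ flatten (map fv_sexpr (succ S)).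
Definition bv_seq S : seq V :=
  flatten (map bv_expr (ante S)) ++ flatten (map bv_sexpr (succ S)).
Definition labels_seq S : seq L :=
  flatten (map labels_expr (ante S)) ++ flatten (map labels_sexpr (succ S)).

Definition fresh_var (z : V) S : bool := (z \notin fv_seq S) && (z \notin bv_seq S).
Definition fresh_label (u : L) S : bool := u \notin labels_seq S.

Definition pure S : Prop := forall x, x \in fv_seq S -> x \notin bv_seq S.

Definition seq_equiv S S' : Prop :=
  Permutation (ante S) (ante S') /\ Permutation (succ S) (succ S').

Definition subst_sexpr (y x : V) (E : sexpr Sg V L) : sexpr Sg V L :=
  match E with
  | Lab w A => Lab w A<[x := y]>
  | Den t z w => Den (subst_term y x t) (subst_var y x z) w
  end.
Definition subst_expr (y x : V) (E : expr Sg V L) : expr Sg V L :=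
  match E with
  | Sx F => subst_sexpr y x F
  | Dom z w => Dom (subst_var y x z) w
  | Rel w v => Rel w v
  end.

(* Side condition on E in Repl; the label of E must be that of the identity. *)
Definition replaceable (w : L) (E : expr Sg V L) : bool :=
  match E with
  | Sx (Lab v A) => (v == w) && is_atom A
  | Sx (Den (TVar _) _ v) => v == w
  | Sx (Den (Iota _ _) _ _) => false
  | Dom _ v => v == w
  | Rel _ _ => false
  end.

Inductive alpha_sexpr : sexpr Sg V L -> sexpr Sg V L -> Prop :=
| alpha_Lab w A B : alpha_form [::] A B -> alpha_sexpr (Lab w A) (Lab w B)
| alpha_Den t s x w : alpha_term [::] t s -> alpha_sexpr (Den t x w) (Den s x w).

Inductive alpha_expr : expr Sg V L -> expr Sg V L -> Prop :=
| alpha_Sx E F : alpha_sexpr E F -> alpha_expr E F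
| alpha_Dom x w : alpha_expr (Dom x w) (Dom x w)
| alpha_Rel w v : alpha_expr (Rel w v) (Rel w v).

Definition alpha_seq S S' : Prop :=
  List.Forall2 alpha_expr (ante S) (ante S') /\
  List.Forall2 alpha_sexpr (succ S) (succ S').

End Sequents.

(* [NEucl] stands for the pair of rules Eucl and its contracted instance. *)
Inductive nlrule : Type := NRef | NSer | NTrans | NEucl | NIncr | NDecr | NCons.

(* [rule N premises conclusion]: rule instances of the calculus whose
   non-logical rules are those in N. No [free_for] condition is needed when the
   substituted variable is fresh for the conclusion. *)
Inductive rule (Sg : signature) (V L : eqType) (N : nlrule -> Prop) :
    seq (sequent Sg V L) -> sequent Sg V L -> Prop :=
| InitAt w p G D : is_atom p ->
    rule N [::] (Sx (Lab w p) :: G ⇒ Lab w p :: D)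
| InitDen y x w G D :
    rule N [::] (Sx (Den (TVar y) x w) :: G ⇒ Den (TVar y) x w :: D)
| InitBot w G D :
    rule N [::] (Sx (Lab w Bot) :: G ⇒ D)
| LAnd w A B G D :
    rule N [:: [:: Sx (Lab w A), Sx (Lab w B) & G] ⇒ D]
           (Sx (Lab w (And A B)) :: G ⇒ D)
| RAnd w A B G D :
    rule N [:: G ⇒ Lab w A :: D; G ⇒ Lab w B :: D]
           (G ⇒ Lab w (And A B) :: D)
| LOr w A B G D :
    rule N [:: Sx (Lab w A) :: G ⇒ D; Sx (Lab w B) :: G ⇒ D]
           (Sx (Lab w (Or A B)) :: G ⇒ D)
| ROr w A B G D :
    rule N [:: G ⇒ [:: Lab w A, Lab w B & D]]
           (G ⇒ Lab w (Or A B) :: D)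
| LImp w A B G D :
    rule N [:: G ⇒ Lab w A :: D; Sx (Lab w B) :: G ⇒ D]
           (Sx (Lab w (Imp A B)) :: G ⇒ D)
| RImp w A B G D :
    rule N [:: Sx (Lab w A) :: G ⇒ Lab w B :: D]
           (G ⇒ Lab w (Imp A B) :: D)
| LAll w x y A G D : free_for y x A ->
    rule N [:: [:: Sx (Lab w A<[x := y]>), Dom y w, Sx (Lab w (All x A)) & G] ⇒ D]
           ([:: Dom y w, Sx (Lab w (All x A)) & G] ⇒ D)
| RAll w x z A G D : fresh_var z (G ⇒ Lab w (All x A) :: D) ->
    rule N [:: Dom z w :: G ⇒ Lab w A<[x := z]> :: D]
           (G ⇒ Lab w (All x A) :: D)
| LEx w x z A G D : fresh_var z (Sx (Lab w (Ex x A)) :: G ⇒ D) ->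
    rule N [:: [:: Dom z w, Sx (Lab w A<[x := z]>) & G] ⇒ D]
           (Sx (Lab w (Ex x A)) :: G ⇒ D)
| REx w x y A G D : free_for y x A ->
    rule N [:: Dom y w :: G ⇒ [:: Lab w (Ex x A), Lab w A<[x := y]> & D]]
           (Dom y w :: G ⇒ Lab w (Ex x A) :: D)
| LBox w v A G D :
    rule N [:: [:: Sx (Lab v A), Rel w v, Sx (Lab w (Box A)) & G] ⇒ D]
           ([:: Rel w v, Sx (Lab w (Box A)) & G] ⇒ D)
| RBox w u A G D : fresh_label u (G ⇒ Lab w (Box A) :: D) ->
    rule N [:: Rel w u :: G ⇒ Lab u A :: D]
           (G ⇒ Lab w (Box A) :: D)
| LDia w u A G D : fresh_label u (Sx (Lab w (Dia A)) :: G ⇒ D) ->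
    rule N [:: [:: Rel w u, Sx (Lab u A) & G] ⇒ D]
           (Sx (Lab w (Dia A)) :: G ⇒ D)
| RDia w v A G D :
    rule N [:: Rel w v :: G ⇒ [:: Lab w (Dia A), Lab v A & D]]
           (Rel w v :: G ⇒ Lab w (Dia A) :: D)
| RefEq w x G D :
    rule N [:: Sx (Lab w (Equ x x)) :: G ⇒ D] (G ⇒ D)
| RigVar w v y z G D :
    rule N [:: [:: Sx (Lab v (Equ y z)), Sx (Lab w (Equ y z)) & G] ⇒ D]
           (Sx (Lab w (Equ y z)) :: G ⇒ D)
| Repl w x y z E G D : replaceable w E ->
    rule N [:: [:: subst_expr z x E, subst_expr y x E, Sx (Lab w (Equ y z)) & G] ⇒ D]
           ([:: subst_expr y x E, Sx (Lab w (Equ y z)) & G] ⇒ D)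
| LLam w x z B t G D : fresh_var z (Sx (Lab w (Lam x B t)) :: G ⇒ D) ->
    rule N [:: [:: Sx (Den t z w), Sx (Lab w B<[x := z]>) & G] ⇒ D]
           (Sx (Lab w (Lam x B t)) :: G ⇒ D)
| RLam w x y B t G D : free_for y x B ->
    rule N [:: G ⇒ [:: Lab w (Lam x B t), Den t y w & D];
               G ⇒ [:: Lab w (Lam x B t), Lab w B<[x := y]> & D]]
           (G ⇒ Lab w (Lam x B t) :: D)
| LDen1 w x1 x2 A G D : free_for x2 x1 A ->
    rule N [:: [:: Sx (Lab w A<[x1 := x2]>), Sx (Den (Iota x1 A) x2 w) & G] ⇒ D]
           (Sx (Den (Iota x1 A) x2 w) :: G ⇒ D)
| LDen2 w x1 x2 y A G D : free_for y x1 A ->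
    rule N [:: Sx (Den (Iota x1 A) x2 w) :: G ⇒ Lab w A<[x1 := y]> :: D;
               [:: Sx (Lab w (Equ x2 y)), Sx (Den (Iota x1 A) x2 w) & G] ⇒ D]
           (Sx (Den (Iota x1 A) x2 w) :: G ⇒ D)
| RDen w x1 x2 z A G D : free_for x2 x1 A ->
    fresh_var z (G ⇒ Den (Iota x1 A) x2 w :: D) ->
    rule N [:: G ⇒ Lab w A<[x1 := x2]> :: D;
               Sx (Lab w A<[x1 := z]>) :: G ⇒ Lab w (Equ x2 z) :: D]
           (G ⇒ Den (Iota x1 A) x2 w :: D)
| DenVar w x G D :
    rule N [:: Sx (Den (TVar x) x w) :: G ⇒ D] (G ⇒ D)
| DenId w x y G D :
    rule N [:: [:: Sx (Lab w (Equ y x)), Sx (Den (TVar y) x w) & G] ⇒ D]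
           (Sx (Den (TVar y) x w) :: G ⇒ D)
| Ref_rule w G D : N NRef ->
    rule N [:: Rel w w :: G ⇒ D] (G ⇒ D)
| Ser_rule w u G D : N NSer -> fresh_label u (G ⇒ D) ->
    rule N [:: Rel w u :: G ⇒ D] (G ⇒ D)
| Trans_rule w v u G D : N NTrans ->
    rule N [:: [:: Rel w u, Rel w v, Rel v u & G] ⇒ D]
           ([:: Rel w v, Rel v u & G] ⇒ D)
| Eucl_rule w v u G D : N NEucl ->
    rule N [:: [:: Rel v u, Rel w v, Rel w u & G] ⇒ D]
           ([:: Rel w v, Rel w u & G] ⇒ D)
| EuclC_rule w v G D : N NEucl ->
    rule N [:: [:: Rel v v, Rel w v & G] ⇒ D]
           (Rel w v :: G ⇒ D)
| Incr_rule x w v G D : N NIncr ->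
    rule N [:: [:: Dom x v, Dom x w, Rel w v & G] ⇒ D]
           ([:: Dom x w, Rel w v & G] ⇒ D)
| Decr_rule x w v G D : N NDecr ->
    rule N [:: [:: Dom x w, Dom x v, Rel w v & G] ⇒ D]
           ([:: Dom x v, Rel w v & G] ⇒ D)
| Cons_rule x w G D : N NCons ->
    rule N [:: Dom x w :: G ⇒ D] (G ⇒ D).

Inductive derivation (Sg : signature) (V L : eqType) (N : nlrule -> Prop) :
    sequent Sg V L -> Prop :=
| Derive (Ps : seq (sequent Sg V L)) (C S : sequent Sg V L) :
    rule N Ps C -> seq_equiv S C -> pure S ->
    (forall P, List.In P Ps -> derivation N P) ->
    derivation N S.

Definition derivable (Sg : signature) (V L : eqType) (N : nlrule -> Prop)
    (S : sequent Sg V L) : Prop :=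
  exists S', alpha_seq S S' /\ derivation N S'.

(* Main.v *)
Require Import Defs.
From mathcomp Require Import all_boot.
From Stdlib Require Import Permutation ClassicalEpsilon.
Set Implicit Arguments.
Unset Strict Implicit.
Unset Printing Implicit Defensive.

(** Cut is sound for Kripke semantics, so it suffices that the calculus is sound
    and, without cut, complete. For completeness, first rename the binders of an
    underivable sequent apart from its free variables; purity is then preserved
    as long as eigenvariables also avoid the binders. Applying every rule
    backwards, fairly, yields an increasing sequence of underivable sequents
    whose limit is a Hintikka pair; its active variables and labels, with the
    atoms of the antecedent, form a countermodel. *)

(** * Syntax *)

(* The semantic route spares invertibility, weakening and contraction, which would all have to be
   proved for derivations confined to pure sequents. Their absence is felt once, in the saturation:
   a rule with two principal expressions needs two occurrences, so the case in which the two
   coincide has to be settled by other means.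

   Purity is what makes the countermodel work. Its objects are the active variables themselves, and
   no active variable is ever a binder; hence every object is free for every bound variable, and
   updating a valuation agrees with substituting a name. A variable denotes independently of the
   domains, so an object may belong to the domain of no world.

   Letters, variables and labels come without an enumeration, so fairness is obtained by rounds: a
   state has seen finitely many expressions, which create finitely many obligations with the
   finitely many variables and labels in use, and the next state meets all of them. Choosing an
   underivable premiss, and a next state in each round, is classical. *)
Scheme term_form_ind := Induction for term Sort Prop
  with form_term_ind := Induction for form Sort Prop.
Combined Scheme term_form_mutind from term_form_ind, form_term_ind.

Scheme alpha_term_form_ind := Minimality for alpha_term Sort Prop
  with alpha_form_term_ind := Minimality for alpha_form Sort Prop.
Combined Scheme alpha_mutind from alpha_term_form_ind, alpha_form_term_ind.

Lemma in_perm (T : Type) (a : T) (s : seq T) :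
  List.In a s -> exists s', Permutation s (a :: s').
Proof.
move=> a_s; have [s1 [s2 ->]] := List.in_split _ _ a_s; exists (s1 ++ s2).
exact/Permutation_sym/Permutation_middle.
Qed.

(** Distinct members sit at distinct positions, so both can be brought to the front at once; equal
    ones might be a single occurrence. *)
Lemma in_perm2 (T : Type) (a b : T) (s : seq T) :
  a <> b -> List.In a s -> List.In b s -> exists s', Permutation s [:: a, b & s'].
Proof.
move=> nab a_s b_s; have [s1 p1] := in_perm a_s.
have [//|b_s1] : a = b \/ List.In b s1 by apply: (Permutation_in _ p1).
have [s2 p2] := in_perm b_s1.
exists s2; exact: Permutation_trans p1 (perm_skip _ p2).
Qed.

Section Syntax.
Context {Sg : signature} {V : eqType}.
Implicit Types (t : term Sg V) (A : form Sg V) (x y z : V).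

Lemma mem_fv_subst y x z :
  (forall t, z \in fv_term (subst_term y x t) ->
     (z == y) || (z \in fv_term t) && (z != x)) /\
  (forall A, z \in fv_form (A<[x := y]>) ->
     (z == y) || (z \in fv_form A) && (z != x)).
Proof.
have var u : z = subst_var y x u -> (z == y) || (z == u) && (z != x).
  rewrite /subst_var; case: (u =P x) => [_ ->|/eqP ux ->]; first by rewrite eqxx.
  by rewrite eqxx ux orbT.
have bind u A : (z \in fv_form (A<[x := y]>) -> (z == y) || (z \in fv_form A) && (z != x)) ->
    z \in [seq v <- fv_form (if u == x then A else A<[x := y]>) | v != u] ->
    (z == y) || (z \in [seq v <- fv_form A | v != u]) && (z != x).
  move=> IH; rewrite !mem_filter; case: (u =P x) => [->|_] /andP[zu].
    by move=> ->; rewrite zu orbT.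
  by rewrite zu.
apply: term_form_mutind => /=.
- by move=> u; rewrite !inE => /eqP /var.
- move=> u A IH; exact: bind IH.
- move=> P us /mapP[u uus /var]; case: eqP => //= _ /andP[/eqP zu ->].
  by rewrite andbT zu.
- move=> u v; rewrite !inE => /orP[] /eqP /var; case: (z == y) => //= /andP[-> ->] //.
  by rewrite orbT.
- by [].
- by move=> A IHA B IHB; rewrite !mem_cat => /orP[/IHA|/IHB];
    case: (z == y) => //= /andP[-> ->] //; rewrite orbT.
- by move=> A IHA B IHB; rewrite !mem_cat => /orP[/IHA|/IHB];
    case: (z == y) => //= /andP[-> ->] //; rewrite orbT.
- by move=> A IHA B IHB; rewrite !mem_cat => /orP[/IHA|/IHB];
    case: (z == y) => //= /andP[-> ->] //; rewrite orbT.
- move=> u A IH; exact: bind IH.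
- move=> u A IH; exact: bind IH.
- by [].
- by [].
- move=> u A IHA t IHt; rewrite !mem_cat => /orP[/(bind _ _ IHA)|/IHt];
    case: (z == y) => //= /andP[-> ->] //; by rewrite orbT.
Qed.

Lemma bv_subst y x :
  (forall t, bv_term (subst_term y x t) = bv_term t) /\
  (forall A, bv_form (A<[x := y]>) = bv_form A).
Proof.
apply: term_form_mutind => //=; intros; congruence || idtac;
  by repeat case: ifP => _; congruence.
Qed.

(** The form in which [free_for] conditions are met later: the variables in use during saturation
    and in the countermodel never occur as binders. *)
Lemma free_for_bv y x :
  (forall t, y \notin bv_term t -> free_for_term y x t) /\
  (forall A, y \notin bv_form A -> free_for y x A).
Proof.
have bind z A : (y \notin bv_form A -> free_for y x A) -> y \notin z :: bv_form A ->
    (z == x) || ((z != y) || (x \notin fv_form A)) && free_for y x A.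
  by move=> IH; rewrite inE negb_or eq_sym => /andP[-> /IH ->]; rewrite orbT.
apply: term_form_mutind => //=; try by move=> *; apply: bind.
1-3: by move=> A IHA B IHB; rewrite mem_cat negb_or => /andP[/IHA-> /IHB->].
move=> z A IHA t IHt; rewrite inE mem_cat !negb_or => /and3P[yz yA /IHt->].
by rewrite andbT bind // inE negb_or yz.
Qed.

(** The measure for the truth lemma. An instance [A<[x := y]>] is not a subformula of its quantified
    formula, but replacing variables by variables leaves the size unchanged. *)
Fixpoint term_size t : nat :=
  match t with TVar _ => 1 | Iota _ A => (form_size A).+1 end
with form_size A : nat :=
  match A with
  | Atom _ _ | Equ _ _ | Bot => 1
  | And A B | Or A B | Imp A B => (form_size A + form_size B).+1
  | All _ A | Ex _ A | Box A | Dia A => (form_size A).+1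
  | Lam _ A t => (form_size A + term_size t).+1
  end.

Lemma form_size_subst y x :
  (forall t, term_size (subst_term y x t) = term_size t) /\
  (forall A, form_size (A<[x := y]>) = form_size A).
Proof.
apply: term_form_mutind => //=; intros; congruence || idtac;
  by repeat case: ifP => _; congruence.
Qed.

End Syntax.

(** * Kripke semantics and soundness *)

(* Equality is interpreted by a congruence rather than by the identity: this
   spares a quotient in the countermodel construction. Complex formulas need not
   respect it, since [Repl] only acts on atomic expressions. *)
Record model (Sg : signature) (N : nlrule -> Prop) := Model {
  world : Type;
  object : Type;
  acc : world -> world -> Prop;
  dom : object -> world -> Prop;
  eqo : object -> object -> Prop;
  interp : forall P : letter Sg, world -> (arity P).-tuple object -> Prop;
  eqo_refl : forall d, eqo d d;
  eqo_sym : forall d e, eqo d e -> eqo e d;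
  eqo_trans : forall d e f, eqo d e -> eqo e f -> eqo d f;
  dom_eqo : forall d e w, eqo d e -> dom d w -> dom e w;
  interp_eqo : forall P w (ds es : (arity P).-tuple object),
    (forall i, eqo (tnth ds i) (tnth es i)) -> interp w ds -> interp w es;
  acc_ref : N NRef -> forall w, acc w w;
  (* The loop: [Ser] allows w = u, so its premise can add a fresh reflexive label. *)
  acc_ser : N NSer -> (forall w, exists v, acc w v) /\ (exists v, acc v v);
  acc_trans : N NTrans -> forall w v u, acc w v -> acc v u -> acc w u;
  acc_eucl : N NEucl -> forall w v u, acc w v -> acc w u -> acc v u;
  dom_incr : N NIncr -> forall d w v, acc w v -> dom d w -> dom d v;
  dom_decr : N NDecr -> forall d w v, acc w v -> dom d v -> dom d w;
  dom_cons : N NCons -> forall d w, dom d w }.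

Definition upd (K : eqType) (T : Type) (s : K -> T) (x : K) (d : T) : K -> T :=
  fun z => if z == x then d else s z.

Section Semantics.
Context {Sg : signature} {V L : eqType}.
Variables (N : nlrule -> Prop) (M : model Sg N).
Implicit Types (s : V -> object M) (l : L -> world M) (w : world M).

(** Uniqueness of a description is meant up to [eqo] and ranges over all objects, not only over the
    domain of [w]; this matches [LDen2] and [RDen], whose premisses carry no domain atom. *)
Fixpoint den s w (t : term Sg V) (d : object M) : Prop :=
  match t with
  | TVar y => eqo (s y) d
  | Iota x A => eval (upd s x d) w A /\
                (forall e, eval (upd s x e) w A -> eqo d e)
  end
with eval s w (A : form Sg V) : Prop :=
  match A with
  | Atom P xs => interp w (map_tuple s xs)
  | Equ x y => eqo (s x) (s y)
  | Bot => False
  | And A B => eval s w A /\ eval s w B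
  | Or A B => eval s w A \/ eval s w B
  | Imp A B => eval s w A -> eval s w B
  | All x A => forall d, dom d w -> eval (upd s x d) w A
  | Ex x A => exists2 d, dom d w & eval (upd s x d) w A
  | Box A => forall v, acc w v -> eval s v A
  | Dia A => exists2 v, acc w v & eval s v A
  | Lam x A t => exists2 d, den s w t d & eval (upd s x d) w A
  end.

Lemma iff_all (T : Type) (P Q : T -> Prop) :
  (forall d, P d <-> Q d) -> (forall d, P d) <-> (forall d, Q d).
Proof. by move=> PQ; split=> H d; apply/PQ. Qed.

Lemma iff_ex2 (T : Type) (D P Q : T -> Prop) :
  (forall d, P d <-> Q d) -> (exists2 d, D d & P d) <-> (exists2 d, D d & Q d).
Proof. by move=> PQ; split=> -[d Dd /PQ]; exists d. Qed.

Lemma eval_ext :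
  (forall t s s' w d, {in fv_term t, s =1 s'} -> den s w t d <-> den s' w t d) /\
  (forall (A : form Sg V) s s' w, {in fv_form A, s =1 s'} -> eval s w A <-> eval s' w A).
Proof.
have ext_upd s s' x (X : seq V) (d : object M) :
    {in [seq z <- X | z != x], s =1 s'} -> {in X, upd s x d =1 upd s' x d}.
  move=> ss z zX; rewrite /upd; case: ifP => // /negbT zx.
  by apply: ss; rewrite mem_filter zx.
have cat2 s s' (X Y : seq V) : {in X ++ Y, s =1 s'} -> {in X, s =1 s'} /\ {in Y, s =1 s'}.
  by move=> ss; split=> z zX; apply: ss; rewrite mem_cat zX ?orbT.
apply: term_form_mutind => /=.
- by move=> x s s' w d ss; rewrite ss // inE.
- move=> x A IH s s' w d ss.
  have E e : eval (upd s x e) w A <-> eval (upd s' x e) w A by apply/IH/ext_upd.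
  by rewrite E (iff_all (Q := fun e => eval (upd s' x e) w A -> eqo d e)) // => e; rewrite E.
- move=> P xs s s' w ss; suff -> : map_tuple s xs = map_tuple s' xs by [].
  by apply: eq_from_tnth => i; rewrite !tnth_map ss // mem_tnth.
- by move=> x y s s' w ss; rewrite !ss // !inE eqxx ?orbT.
- by [].
- by move=> A IHA B IHB s s' w /cat2[sA sB]; rewrite (IHA _ _ _ sA) (IHB _ _ _ sB).
- by move=> A IHA B IHB s s' w /cat2[sA sB]; rewrite (IHA _ _ _ sA) (IHB _ _ _ sB).
- by move=> A IHA B IHB s s' w /cat2[sA sB]; rewrite (IHA _ _ _ sA) (IHB _ _ _ sB).
- by move=> x A IH s s' w ss; apply: iff_all => d; rewrite (IH _ (upd s' x d)) //; apply: ext_upd.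
- by move=> x A IH s s' w ss; apply: iff_ex2 => d; rewrite (IH _ (upd s' x d)) //; apply: ext_upd.
- by move=> A IH s s' w ss; apply: iff_all => v; rewrite (IH _ s').
- by move=> A IH s s' w ss; apply: iff_ex2 => v; rewrite (IH _ s').
- move=> x A IHA t IHt s s' w /cat2[sA st].
  have E d : eval (upd s x d) w A <-> eval (upd s' x d) w A by apply/IHA/ext_upd.
  by split=> -[d /(IHt _ _ _ _ st) td /E Ad]; exists d.
Qed.

Lemma eval_subst y x :
  (forall t s w d, free_for_term y x t ->
     den s w (subst_term y x t) d <-> den (upd s x (s y)) w t d) /\
  (forall A s w, free_for y x A ->
     eval s w (A<[x := y]>) <-> eval (upd s x (s y)) w A).
Proof.
have var s u : s (subst_var y x u) = upd s x (s y) u.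
  by rewrite /subst_var /upd; case: eqP.
have bind z A s w d : (forall s w, free_for y x A ->
       eval s w (A<[x := y]>) <-> eval (upd s x (s y)) w A) ->
    (z == x) || ((z != y) || (x \notin fv_form A)) && free_for y x A ->
    eval (upd s z d) w (if z == x then A else A<[x := y]>) <->
    eval (upd (upd s x (s y)) z d) w A.
  move=> IH; case: (z =P x) => [-> _|/eqP zx /= /andP[ok ff]].
    by apply eval_ext => u _; rewrite /upd; case: ifP.
  rewrite IH //; apply eval_ext => u uA; rewrite /upd.
  (* The valuations could differ only at [x], and only if [z] were [y]. As [x] is free in [A] here,
     the side condition excludes that. *)
  case: (u =P x) => [ux|_].
    move: ok; rewrite -ux uA orbF [y == z]eq_sym => /negPf->.
    by rewrite ux [x == z]eq_sym (negPf zx).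
  by [].
apply: term_form_mutind => /=.
- by move=> z s w d _; rewrite var.
- move=> z A IH s w d ff; have E e := bind z A s w e IH ff.
  rewrite E (iff_all (Q := fun e => eval (upd (upd s x (s y)) z e) w A -> eqo d e)) //.
  by move=> e; rewrite E.
- move=> P xs s w _.
  suff -> : map_tuple s (map_tuple (subst_var y x) xs) = map_tuple (upd s x (s y)) xs by [].
  by apply: eq_from_tnth => i; rewrite !tnth_map var.
- by move=> u v s w _; rewrite !var.
- by [].
- by move=> A IHA B IHB s w /andP[/IHA-> /IHB->].
- by move=> A IHA B IHB s w /andP[/IHA-> /IHB->].
- by move=> A IHA B IHB s w /andP[/IHA-> /IHB->].
- by move=> z A IH s w ff; apply: iff_all => d; rewrite (bind z A s w d IH ff).
- by move=> z A IH s w ff; apply: iff_ex2 => d; exact: (bind z A s w d IH ff).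
- by move=> A IH s w ff; apply: iff_all => v; rewrite IH.
- by move=> A IH s w ff; apply: iff_ex2 => v; apply: IH.
- move=> z A IHA t IHt s w /andP[ff ft].
  have E d := bind z A s w d IHA ff.
  by split=> -[d /(IHt _ _ _ ft) td /E Ad]; exists d.
Qed.

Lemma eval_alpha e :
  (forall t t', @alpha_term Sg V e t t' ->
     forall s s' w d, (forall x y, alpha_var e x y -> s x = s' y) ->
     den s w t d <-> den s' w t' d) /\
  (forall A B, @alpha_form Sg V e A B ->
     forall s s' w, (forall x y, alpha_var e x y -> s x = s' y) ->
     eval s w A <-> eval s' w B).
Proof.
have ext s s' e1 x y (d : object M) : (forall x y, alpha_var e1 x y -> s x = s' y) ->
    forall u v, alpha_var ((x, y) :: e1) u v -> upd s x d u = upd s' y d v.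
  by move=> ss u v /= /orP[/andP[/eqP-> /eqP->]|/and3P[ux vy /ss]];
    rewrite /upd ?eqxx // (negPf ux) (negPf vy).
move: e; apply: alpha_mutind => /=.
- by move=> e x y xy s s' w d ss; rewrite (ss _ _ xy).
- move=> e x y A B _ IH s s' w d ss.
  have E f : eval (upd s x f) w A <-> eval (upd s' y f) w B by apply/IH/ext.
  by rewrite E (iff_all (Q := fun f => eval (upd s' y f) w B -> eqo d f)) // => f; rewrite E.
- move=> e P xs ys xys s s' w ss; suff -> : map_tuple s xs = map_tuple s' ys by [].
  by apply: eq_from_tnth => i; rewrite !tnth_map; apply: ss.
- by move=> e x1 x2 y1 y2 e1 e2 s s' w ss; rewrite (ss _ _ e1) (ss _ _ e2).
- by [].
- by move=> e A A' B B' _ IHA _ IHB s s' w ss; rewrite (IHA _ _ _ ss) (IHB _ _ _ ss).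
- by move=> e A A' B B' _ IHA _ IHB s s' w ss; rewrite (IHA _ _ _ ss) (IHB _ _ _ ss).
- by move=> e A A' B B' _ IHA _ IHB s s' w ss; rewrite (IHA _ _ _ ss) (IHB _ _ _ ss).
- by move=> e x y A B _ IH s s' w ss; apply: iff_all => d; rewrite (IH _ (upd s' y d)) //; apply: ext.
- by move=> e x y A B _ IH s s' w ss; apply: iff_ex2 => d; rewrite (IH _ (upd s' y d)) //; apply: ext.
- by move=> e A B _ IH s s' w ss; apply: iff_all => v; rewrite (IH _ s').
- by move=> e A B _ IH s s' w ss; apply: iff_ex2 => v; rewrite (IH _ s').
- move=> e x y A B t t' _ IHA _ IHt s s' w ss.
  have E d : eval (upd s x d) w A <-> eval (upd s' y d) w B by apply/IHA/ext.
  by split=> -[d /(IHt _ _ _ _ ss) td /E Ad]; exists d.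
Qed.

End Semantics.

Fixpoint all_prop (T : Type) (P : T -> Prop) (s : seq T) : Prop :=
  if s is a :: s' then P a /\ all_prop P s' else True.

Lemma all_propP (T : Type) (P : T -> Prop) (s : seq T) :
  all_prop P s <-> forall a, List.In a s -> P a.
Proof.
elim: s => [|a s IH] //=; split=> [[Pa /IH Ps] b [<-|/Ps]//|H].
by split; [apply: H; left | apply/IH => b bs; apply: H; right].
Qed.

Lemma all_prop_perm (T : Type) (P : T -> Prop) (s s' : seq T) :
  Permutation s s' -> all_prop P s -> all_prop P s'.
Proof.
move=> p /all_propP Ps; apply/all_propP => a a_s'; apply: Ps.
by apply: Permutation_in a_s'; apply: Permutation_sym.
Qed.

Lemma all_prop_Forall2 (T U : Type) (R : T -> U -> Prop) (P : T -> Prop) (Q : U -> Prop) s s' :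
  (forall a b, R a b -> P a <-> Q b) -> List.Forall2 R s s' -> all_prop P s <-> all_prop Q s'.
Proof. by move=> PQ; elim=> //= a b l l' /PQ-> _ ->. Qed.

Lemma all_prop_cat (T : Type) (P : T -> Prop) (s s' : seq T) :
  all_prop P (s ++ s') <-> all_prop P s /\ all_prop P s'.
Proof. by elim: s => [|a s IH] /=; rewrite ?IH; tauto. Qed.

(** * Refutation of sequents and soundness of the rules *)

Section Validity.
Context {Sg : signature} {V L : eqType} (N : nlrule -> Prop).

Section Refutation.
Variable M : model Sg N.
Implicit Types (s : V -> object M) (l : L -> world M).

Definition sholds s l (E : sexpr Sg V L) : Prop :=
  match E with Lab w A => eval s (l w) A | Den t x w => den s (l w) t (s x) end.

Definition holds s l (E : expr Sg V L) : Prop :=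
  match E with
  | Sx F => sholds s l F
  | Dom x w => dom (s x) (l w)
  | Rel w v => acc (l w) (l v)
  end.

Definition refutes s l (S : sequent Sg V L) : Prop :=
  all_prop (holds s l) (ante S) /\ all_prop (fun F => ~ sholds s l F) (succ S).

Lemma sholds_ext s s' l l' E :
  {in fv_sexpr E, s =1 s'} -> {in labels_sexpr E, l =1 l'} -> sholds s l E <-> sholds s' l' E.
Proof.
case: E => [w A|t x w] /= ss ll; rewrite ll ?inE ?eqxx //.
  exact: (proj2 (eval_ext M)).
rewrite ss ?inE ?eqxx //; apply: (proj1 (eval_ext M)) => z zt.
by apply: ss; rewrite inE zt orbT.
Qed.

Lemma holds_ext s s' l l' E :
  {in fv_expr E, s =1 s'} -> {in labels_expr E, l =1 l'} -> holds s l E <-> holds s' l' E.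
Proof.
case: E => [F|x w|w v] /= ss ll; first exact: sholds_ext.
  by rewrite ss ?ll ?inE ?eqxx.
by rewrite !ll ?inE ?eqxx ?orbT.
Qed.

Lemma refutes_ext s s' l l' S :
  {in fv_seq S, s =1 s'} -> {in labels_seq S, l =1 l'} -> refutes s l S <-> refutes s' l' S.
Proof.
case: S => G D; rewrite /refutes /fv_seq /labels_seq /= => ss ll.
have -> : all_prop (holds s l) G <-> all_prop (holds s' l') G.
  have {}ss : {in flatten (map fv_expr G), s =1 s'} by move=> z zG; apply: ss; rewrite mem_cat zG.
  have {}ll : {in flatten (map labels_expr G), l =1 l'} by move=> z zG; apply: ll; rewrite mem_cat zG.
  elim: G ss ll => //= a G IH ss ll; rewrite (@holds_ext s s' l l') ?IH //.
  1-2: by move=> z zG; [apply: ss || apply: ll]; rewrite mem_cat zG orbT.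
  1-2: by move=> z zG; [apply: ss || apply: ll]; rewrite mem_cat zG.
have {}ss : {in flatten (map fv_sexpr D), s =1 s'} by move=> z zG; apply: ss; rewrite mem_cat zG orbT.
have {}ll : {in flatten (map labels_sexpr D), l =1 l'} by move=> z zG; apply: ll; rewrite mem_cat zG orbT.
suff -> : all_prop (fun F => ~ sholds s l F) D <-> all_prop (fun F => ~ sholds s' l' F) D by [].
elim: D ss ll => //= a D IH ss ll; rewrite (@sholds_ext s s' l l') ?IH //.
1-2: by move=> z zG; [apply: ss || apply: ll]; rewrite mem_cat zG orbT.
1-2: by move=> z zG; [apply: ss || apply: ll]; rewrite mem_cat zG.
Qed.

Lemma refutes_fresh_var z d s l S :
  fresh_var z S -> refutes s l S -> refutes (upd s z d) l S.
Proof.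
move=> /andP[zS _]; apply refutes_ext => // x xS.
by rewrite /upd; case: eqP => // e; rewrite -e xS in zS.
Qed.

Lemma refutes_fresh_label u w s l S :
  fresh_label u S -> refutes s l S -> refutes s (upd l u w) S.
Proof.
move=> uS; apply refutes_ext => // x xS.
by rewrite /upd; case: eqP => // e; rewrite /fresh_label -e xS in uS.
Qed.

Lemma refutes_equiv s l S S' : seq_equiv S S' -> refutes s l S -> refutes s l S'.
Proof. by move=> [pa ps] [/(all_prop_perm pa) ? /(all_prop_perm ps)]. Qed.

Lemma alpha_refutes s l S S' : alpha_seq S S' -> refutes s l S <-> refutes s l S'.
Proof.
have sx E F : alpha_sexpr E F -> sholds s l E <-> sholds s l F.
  case=> [w A B AB|t t' x w tt'] /=.
    by apply: (proj2 (eval_alpha M _) _ _ AB) => x y /eqP->.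
  by apply: (proj1 (eval_alpha M _) _ _ tt') => {x}x y /eqP->.
move=> [aG aD]; rewrite /refutes.
rewrite (all_prop_Forall2 _ aG (Q := holds s l)); last by move=> ? ? [].
by rewrite (all_prop_Forall2 _ aD (Q := fun F => ~ sholds s l F)) // => a b /sx->.
Qed.

(** Replaceable expressions are atomic, and on these [eqo] is a congruence by the axioms of
    [model]. *)
Lemma holds_replace w x y z s l E : replaceable w E -> eqo (s y) (s z) ->
  holds s l (subst_expr y x E) -> holds s l (subst_expr z x E).
Proof.
have eqv u : eqo (s y) (s z) -> eqo (s (subst_var y x u)) (s (subst_var z x u)).
  by rewrite /subst_var; case: ifP => // _ _; apply: eqo_refl.
case: E => [[v A|[u|//] x' v]|x' v|//] /=.
- rewrite andbC; case: A => //= [P us|u1 u2] _ yz.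
    by apply: interp_eqo => i; rewrite !tnth_map; apply: eqv.
  by move=> /(eqo_trans (eqo_sym (eqv _ yz)))/eqo_trans; apply; apply: eqv.
- move=> _ yz /(eqo_trans (eqo_sym (eqv _ yz)))/eqo_trans; apply; apply: eqv; exact: yz.
- by move=> _ yz; apply: dom_eqo; apply: eqv.
Qed.

End Refutation.

Lemma fresh_var_succ z (G : seq (expr Sg V L)) F D :
  fresh_var z (G ⇒ F :: D) -> (z \notin fv_sexpr F) && (z \notin bv_sexpr F).
Proof. by rewrite /fresh_var /fv_seq /bv_seq /= !mem_cat !negb_or => /andP[/and3P[_ -> _] /and3P[_ -> _]]. Qed.

Lemma fresh_var_ante z E (G : seq (expr Sg V L)) (D : seq (sexpr Sg V L)) :
  fresh_var z (E :: G ⇒ D) -> (z \notin fv_expr E) && (z \notin bv_expr E).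
Proof.
by rewrite /fresh_var /fv_seq /bv_seq /= !mem_cat !negb_or -!andbA => /and5P[-> _ _ -> _].
Qed.

Lemma fresh_label_succ u (G : seq (expr Sg V L)) F D :
  fresh_label u (G ⇒ F :: D) -> u \notin labels_sexpr F.
Proof. by rewrite /fresh_label /labels_seq /= !mem_cat !negb_or => /and3P[_ -> _]. Qed.

Lemma fresh_label_ante u E (G : seq (expr Sg V L)) (D : seq (sexpr Sg V L)) :
  fresh_label u (E :: G ⇒ D) -> u \notin labels_expr E.
Proof. by rewrite /fresh_label /labels_seq /= !mem_cat !negb_or -andbA => /and3P[-> _ _]. Qed.

(** Serves the rules with an eigenvariable: an object witnessing the binder [x] becomes the value of
    the eigenvariable [z]. *)
Lemma eval_subst_fresh (M : model Sg N) (s : V -> object M) z x A w d :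
  z \notin bv_form A -> z \notin [seq v <- fv_form A | v != x] ->
  eval (upd s z d) w (A<[x := z]>) <-> eval (upd s x d) w A.
Proof.
move=> zb zf; rewrite (proj2 (eval_subst M z x)) ?(proj2 (free_for_bv z x)) //.
apply eval_ext => u uA; rewrite /upd eqxx; case: (u =P x) => // /eqP ux.
by case: eqP => // uz; move: zf; rewrite mem_filter -uz ux uA.
Qed.

Definition refutable_in (M : model Sg N) (Ps : seq (sequent Sg V L)) : Prop :=
  exists P (s : V -> object M) (l : L -> world M), List.In P Ps /\ refutes s l P.

(** Local soundness read upwards. The model stays the same; only the value of an eigenvariable or of
    a fresh label is changed. An initial sequent has no premiss, so for it the conclusion says that
    no refutation exists. *)
Lemma rule_refutes (M : model Sg N) Ps C (s : V -> object M) (l : L -> world M) :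
  rule N Ps C -> refutes s l C -> refutable_in M Ps.
Proof.
have fst_prem S Ps' s' l' : @refutes M s' l' S -> refutable_in M (S :: Ps').
  by exists S, s', l'; split; [left|].
have snd_prem S S' Ps' s' l' : @refutes M s' l' S -> refutable_in M [:: S', S & Ps'].
  by exists S, s', l'; split; [right; left|].
have sub y x A w : free_for y x A -> eval s w (A<[x := y]>) <-> eval (upd s x (s y)) w A.
  by move=> ff; apply (proj2 (eval_subst M y x)).
have updz z (d : object M) : upd s z d z = d by rewrite /upd eqxx.
have updl u (w : world M) : upd l u w u = w by rewrite /upd eqxx.
case=> {Ps C}.
- by move=> w p G D _ [/= [? _] [? _]].
- by move=> y x w G D [/= [? _] [? _]].
- by move=> w G D [/= []].
- by move=> w A B G D [/= [[? ?] ?] ?]; apply: (fst_prem _ _ s l).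
- move=> w A B G D [/= ? [nAB ?]]; have [?|?] := classic (eval s (l w) A).
    by apply: (snd_prem _ _ _ s l); split=> //=; tauto.
  by apply: (fst_prem _ _ s l).
- by move=> w A B G D [/= [[?|?] ?] ?]; [apply: (fst_prem _ _ s l)|apply: (snd_prem _ _ _ s l)].
- by move=> w A B G D [/= ? [? ?]]; apply: (fst_prem _ _ s l); split=> //=; tauto.
- move=> w A B G D [/= [AB ?] ?]; have [?|?] := classic (eval s (l w) A).
    by apply: (snd_prem _ _ _ s l); split=> //=; tauto.
  by apply: (fst_prem _ _ s l).
- move=> w A B G D [/= ? [nAB ?]]; apply: (fst_prem _ _ s l).
  by have [?|?] := classic (eval s (l w) A); split=> //=; tauto.
- move=> w x y A G D ff [/= [yw [all ?]] ?]; apply: (fst_prem _ _ s l); split=> //=.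
  by split=> //; apply sub => //; apply: all.
- move=> w x z A G D fr H; have [/= _ [nall _]] := H.
  have {nall}[d nd] := not_all_ex_not _ _ nall.
  have [/= ? [? ?]] := refutes_fresh_var d fr H.
  apply: (fst_prem _ _ (upd s z d) l).
  have /andP[/= zf] := fresh_var_succ fr; rewrite inE negb_or => /andP[_ zb].
  by rewrite /refutes /= eval_subst_fresh // updz; tauto.
- move=> w x z A G D fr H; have [/= [[d dw Ad] _] _] := H.
  have [/= [? ?] ?] := refutes_fresh_var d fr H.
  apply: (fst_prem _ _ (upd s z d) l).
  have /andP[/= zf] := fresh_var_ante fr; rewrite inE negb_or => /andP[_ zb].
  by rewrite /refutes /= eval_subst_fresh // updz; tauto.
- move=> w x y A G D ff [/= [yw ?] [nex ?]]; apply: (fst_prem _ _ s l); split=> //=.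
  by do 2 split=> //; rewrite sub // => Ay; apply: nex; exists (s y).
- move=> w v A G D [/= [wv [all ?]] ?]; apply: (fst_prem _ _ s l); split=> //=.
  by split=> //; apply: all.
- move=> w u A G D fr H; have [/= _ [nall _]] := H.
  have {nall}[v nv] := not_all_ex_not _ _ nall.
  have [/= ? [? ?]] := refutes_fresh_label v fr H.
  apply: (fst_prem _ _ s (upd l u v)).
  have /= := fresh_label_succ fr; rewrite inE => /negPf uw.
  by rewrite /refutes /= updl {1}/upd eq_sym uw; tauto.
- move=> w u A G D fr H; have [/= [[v wv Av] _] _] := H.
  have [/= [? ?] ?] := refutes_fresh_label v fr H.
  apply: (fst_prem _ _ s (upd l u v)).
  have /= := fresh_label_ante fr; rewrite inE => /negPf uw.
  by rewrite /refutes /= updl {1}/upd eq_sym uw; tauto.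
- move=> w v A G D [/= [wv ?] [nex ?]]; apply: (fst_prem _ _ s l); split=> //=.
  by do 2 split=> //; move=> Av; apply: nex; exists (l v).
- by move=> w x G D [/= ? ?]; apply: (fst_prem _ _ s l); do 2 split=> //=; apply: eqo_refl.
- by move=> w v y z G D [/= [? ?] ?]; apply: (fst_prem _ _ s l).
- move=> w x y z E G D rE [/= [Ey [yz ?]] ?]; apply: (fst_prem _ _ s l); split=> //=.
  by split=> //; apply: holds_replace rE yz Ey.
- move=> w x z B t G D fr H; have [/= [[d td Bd] _] _] := H.
  have [/= [? ?] ?] := refutes_fresh_var d fr H.
  apply: (fst_prem _ _ (upd s z d) l).
  have /andP[/=] := fresh_var_ante fr.
  rewrite inE !mem_cat !negb_or => /andP[zf zt] /and3P[_ zb _].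
  rewrite /refutes /= eval_subst_fresh // updz; split=> //; split=> //.
  move: td; apply (proj1 (eval_ext M)) => v vt; rewrite /upd; case: eqP => // e.
  by rewrite -e vt in zt.
- move=> w x y B t G D ff [/= ? [nlam ?]]; have [ty|?] := classic (den s (l w) t (s y)).
    apply: (snd_prem _ _ _ s l); split=> //=; do 2 split=> //.
    by rewrite sub // => By; apply: nlam; exists (s y).
  by apply: (fst_prem _ _ s l).
- move=> w x1 x2 A G D ff [/= [[Ax un] ?] ?]; apply: (fst_prem _ _ s l); split=> //=.
  by rewrite sub.
- move=> w x1 x2 y A G D ff [/= [[Ax un] ?] ?].
  have [Ay|nAy] := classic (eval s (l w) (A<[x1 := y]>)).
    apply: (snd_prem _ _ _ s l); split=> //=; split=> //.
    by apply: un; rewrite -sub.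
  by apply: (fst_prem _ _ s l).
- move=> w x1 x2 z A G D ff fr H; have [/= ? [nd ?]] := H.
  have [Ax|nAx] := classic (eval s (l w) (A<[x1 := x2]>)); last by apply: (fst_prem _ _ s l).
  (* Since [A] holds of [x2], the description can fail only by uniqueness; an object violating it
     interprets the eigenvariable. *)
  have [d nAd] : exists d, ~ (eval (upd s x1 d) (l w) A -> eqo (s x2) d).
    by apply: not_all_ex_not => un; apply: nd; rewrite -sub.
  have [/= ? [? ?]] := refutes_fresh_var d fr H.
  have /andP[/=] := fresh_var_succ fr.
  rewrite !inE !negb_or => /andP[zx2 zf] /andP[_ zb].
  apply: (snd_prem _ _ _ (upd s z d) l).
  have sx2 : upd s z d x2 = s x2 by rewrite /upd eq_sym (negPf zx2).
  rewrite /refutes /= eval_subst_fresh // updz sx2.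
  by split; [split=> //|split=> //]; apply: NNPP => ?; apply: nAd.
- by move=> w x G D [/= ? ?]; apply: (fst_prem _ _ s l); do 2 split=> //=; apply: eqo_refl.
- by move=> w x y G D [/= [? ?] ?]; apply: (fst_prem _ _ s l).
- by move=> w G D r [/= ? ?]; apply: (fst_prem _ _ s l); do 2 split=> //=; apply: acc_ref.
(* If [w] is itself the fresh label, the premiss adds a loop and the label must move to a reflexive
   world; otherwise a successor of [l w] serves. *)
- move=> w u G D r fr H; have [v wv] : exists v, if w == u then acc v v else acc (l w) v.
    by have [ser refl] := @acc_ser _ _ M r; case: (w == u).
  have [/= ? ?] := refutes_fresh_label v fr H.
  apply: (fst_prem _ _ s (upd l u v)); do 2 split=> //=.
  by rewrite updl /upd; case: (w == u) wv.
- move=> w v u G D r [/= [wv [vu ?]] ?]; apply: (fst_prem _ _ s l); do 2 split=> //=.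
  exact: acc_trans wv vu.
- move=> w v u G D r [/= [wv [wu ?]] ?]; apply: (fst_prem _ _ s l); do 2 split=> //=.
  exact: acc_eucl wv wu.
- move=> w v G D r [/= [wv ?] ?]; apply: (fst_prem _ _ s l); do 2 split=> //=.
  exact: (acc_eucl r wv wv).
- move=> x w v G D r [/= [xw [wv ?]] ?]; apply: (fst_prem _ _ s l); do 2 split=> //=.
  exact: dom_incr wv xw.
- move=> x w v G D r [/= [xv [wv ?]] ?]; apply: (fst_prem _ _ s l); do 2 split=> //=.
  exact: dom_decr wv xv.
- by move=> x w G D r [/= ? ?]; apply: (fst_prem _ _ s l); do 2 split=> //=; apply: dom_cons.
Qed.

Lemma derivation_sound (M : model Sg N) (S : sequent Sg V L) :
  derivation N S -> forall (s : V -> object M) (l : L -> world M), ~ refutes s l S.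
Proof.
elim=> {S} Ps C S r SC _ _ IH s l /(refutes_equiv SC) /(rule_refutes r)[P [s' [l' [PPs]]]].
exact: IH.
Qed.

Lemma derivable_sound (M : model Sg N) (S : sequent Sg V L) :
  derivable N S -> forall (s : V -> object M) (l : L -> world M), ~ refutes s l S.
Proof. by move=> [S' [SS' dS']] s l /(alpha_refutes s l SS')/(derivation_sound dS'). Qed.

End Validity.

(** * Hintikka pairs and countermodels *)

Lemma inP (K : eqType) (x : K) (s : seq K) : reflect (List.In x s) (x \in s).
Proof.
elim: s => [|a s IH] /=; first by constructor.
rewrite inE eq_sym; apply: (iffP orP) => -[/eqP|/IH]; by [left|right].
Qed.

Section Hintikka.
Context {Sg : signature} {V L : eqType} (N : nlrule -> Prop).

(* [hole] is the variable x of the rule Repl; as it occurs in no sequent, the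
   listed templates reach every replacement of one argument place. *)
Definition templates (hole : V) (E : expr Sg V L) : seq (expr Sg V L) :=
  match E with
  | Sx (Lab w (Atom P xs)) =>
      [seq Sx (Lab w (Atom P [tuple if j == i then hole else tnth xs j | j < _])) | i <- enum 'I_(arity P)]
  | Sx (Lab w (Equ x y)) => [:: Sx (Lab w (Equ hole y)); Sx (Lab w (Equ x hole))]
  | Sx (Den (TVar x) y w) => [:: Sx (Den (TVar hole) y w)]
  | Dom x w => [:: Dom hole w]
  | _ => [::]
  end.

(** * Saturation conditions, one family for each shape of principal part *)

Section Saturation.
Variables (hole : V) (left_ : expr Sg V L -> Prop) (right_ : sexpr Sg V L -> Prop).

(** These conditions come from the rules without principal expression, so they are imposed at all
    active variables and labels. The loop under [NSer] comes from the instance of [Ser_rule] in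
    which both labels are the fresh one. *)
Definition sat_params (y : V) (v : L) : Prop :=
  [/\ left_ (Lab v (Equ y y)), left_ (Den (TVar y) y v),
      N NRef -> left_ (Rel v v),
      N NSer -> (exists u, left_ (Rel v u)) /\ (exists u, left_ (Rel u u))
    & N NCons -> left_ (Dom y v)].

(** The parameter [v] is the target label of [RigVar] and [y] the second variable of [LDen2]. On the
    left, [All] and [Box] act only together with a domain or relational atom and are treated in
    [sat_left2]. *)
Definition sat_left (E : expr Sg V L) (y : V) (v : L) : Prop :=
  match E with
  | Sx (Lab w A) =>
    match A with
    | And A B => left_ (Lab w A) /\ left_ (Lab w B)
    | Or A B => left_ (Lab w A) \/ left_ (Lab w B)
    | Imp A B => right_ (Lab w A) \/ left_ (Lab w B)
    | Ex x A => exists z, left_ (Dom z w) /\ left_ (Lab w A<[x := z]>)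
    | Dia A => exists u, left_ (Rel w u) /\ left_ (Lab u A)
    | Lam x A t => exists z, left_ (Den t z w) /\ left_ (Lab w A<[x := z]>)
    | Equ x z => left_ (Lab v (Equ x z))
    | _ => True
    end
  | Sx (Den (TVar x) z w) => left_ (Lab w (Equ x z))
  | Sx (Den (Iota x A) z w) =>
      left_ (Lab w A<[x := z]>) /\
      (right_ (Lab w A<[x := y]>) \/ left_ (Lab w (Equ z y)))
  | _ => True
  end.

(** The parameter [y] is the variable chosen in [RLam]. On the right, [Ex] and [Dia] need an
    antecedent atom and are treated in [sat_left_right]. *)
Definition sat_right (F : sexpr Sg V L) (y : V) : Prop :=
  match F with
  | Lab w A =>
    match A with
    | And A B => right_ (Lab w A) \/ right_ (Lab w B)
    | Or A B => right_ (Lab w A) /\ right_ (Lab w B)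
    | Imp A B => left_ (Lab w A) /\ right_ (Lab w B)
    | All x A => exists z, left_ (Dom z w) /\ right_ (Lab w A<[x := z]>)
    | Box A => exists u, left_ (Rel w u) /\ right_ (Lab u A)
    | Lam x A t => right_ (Den t y w) \/ right_ (Lab w A<[x := y]>)
    | _ => True
    end
  | Den (Iota x A) z w =>
      right_ (Lab w A<[x := z]>) \/
      (exists y, left_ (Lab w A<[x := y]>) /\ right_ (Lab w (Equ z y)))
  | _ => True
  end.

Definition sat_left2 (E1 E2 : expr Sg V L) : Prop :=
  match E1, E2 with
  | Dom y w, Sx (Lab w' (All x A)) => w = w' -> left_ (Lab w A<[x := y]>)
  | Rel w v, Sx (Lab w' (Box A)) => w = w' -> left_ (Lab v A)
  | Dom x u, Rel w v => (N NIncr -> u = w -> left_ (Dom x v)) /\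
                        (N NDecr -> u = v -> left_ (Dom x w))
  | Rel w v, Rel w' u => (N NTrans -> v = w' -> left_ (Rel w u)) /\
                         (N NEucl -> w = w' -> left_ (Rel v u))
  | _, _ => True
  end.

Definition sat_repl (E1 E2 : expr Sg V L) : Prop :=
  if E2 is Sx (Lab w (Equ y z)) then
    forall E, List.In E (templates hole E1) -> replaceable w E ->
      subst_expr y hole E = E1 -> left_ (subst_expr z hole E)
  else True.

Definition sat_left_right (E : expr Sg V L) (F : sexpr Sg V L) : Prop :=
  match E, F with
  | Dom y w, Lab w' (Ex x A) => w = w' -> right_ (Lab w A<[x := y]>)
  | Rel w v, Lab w' (Dia A) => w = w' -> right_ (Lab v A)
  | _, _ => True
  end.

End Saturation.

(** * The countermodel of a Hintikka pair and the truth lemma *)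

Section Countermodel.
Variables (hole : V) (l : expr Sg V L -> Prop) (r : sexpr Sg V L -> Prop).
Variables (av : pred V) (al : pred L) (x0 : V) (w0 : L).
Hypotheses (x0a : av x0) (w0a : al w0) (hole_a : ~~ av hole).
Hypotheses (l_fv : forall E x, l E -> x \in fv_expr E -> av x)
           (l_bv : forall E x, l E -> x \in bv_expr E -> ~~ av x)
           (l_lab : forall E w, l E -> w \in labels_expr E -> al w)
           (r_fv : forall F x, r F -> x \in fv_sexpr F -> av x)
           (r_bv : forall F x, r F -> x \in bv_sexpr F -> ~~ av x)
           (r_lab : forall F w, r F -> w \in labels_sexpr F -> al w).
Hypotheses (s_params : forall y v, av y -> al v -> sat_params l y v)
           (s_left : forall E y v, l E -> av y -> al v -> sat_left l r E y v)
           (s_right : forall F y, r F -> av y -> sat_right l r F y)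
           (s_left2 : forall E E', l E -> l E' -> sat_left2 l E E')
           (s_repl : forall E E', l E -> l E' -> sat_repl hole l E E')
           (s_left_right : forall E F, l E -> r F -> sat_left_right r E F).
Hypotheses (no_atom : forall w p, is_atom p -> l (Lab w p) -> ~ r (Lab w p))
           (no_den : forall x y w, l (Den (TVar x) y w) -> ~ r (Den (TVar x) y w))
           (no_bot : forall w, ~ l (Lab w Bot)).

Let O : Type := {x | av x}.
Let W : Type := {w | al w}.
(** Valuations are total, so inactive variables receive the default [x0], and likewise inactive
    labels receive [w0]; neither occurs, free or as a label, in an expression of the pair. *)
Let s0 : V -> O := insubd (exist av x0 x0a).
Let l0 : L -> W := insubd (exist al w0 w0a).

Let s0K x : av x -> val (s0 x) = x.
Proof. by move=> ax; rewrite /s0 insubdK. Qed.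
Let l0K w : al w -> val (l0 w) = w.
Proof. by move=> aw; rewrite /l0 insubdK. Qed.
Let vals0 (d : O) : s0 (val d) = d.
Proof. exact: valKd. Qed.

(** Identity is read off at the base label [w0]; closure under [RigVar] makes every other active
    label give the same relation. *)
Let eq_ x y := l (Lab w0 (Equ x y)).

Let eq_at w x y : al w -> l (Lab w (Equ x y)) <-> eq_ x y.
Proof.
by move=> aw; split=> e; [have := s_left e x0a w0a | have := s_left e x0a aw].
Qed.

Let active_eq w x y : l (Lab w (Equ x y)) -> av x && av y.
Proof. by move=> xy; rewrite !(l_fv xy) //= !inE eqxx ?orbT. Qed.

Let not_hole x : av x -> x == hole = false.
Proof. by move=> ax; apply: contraNF hole_a => /eqP <-. Qed.

Let eq_refl x : av x -> eq_ x x.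
Proof. by move=> ax; have [] := s_params ax w0a. Qed.

(** [Repl] along [x = y] rewrites the left side of [x = x], by the template [hole = x]. Transitivity
    is obtained from the right side of [x = y] in the same way. *)
Let eq_sym_ x y : eq_ x y -> eq_ y x.
Proof.
move=> xy; have /andP[ax ay] := active_eq xy.
have := s_repl (eq_refl ax) xy => /= /(_ (Lab w0 (Equ hole x))).
rewrite /= /subst_var !eqxx !not_hole //.
by apply=> //; left.
Qed.

Let eq_trans_ x y z : eq_ x y -> eq_ y z -> eq_ x z.
Proof.
move=> xy yz; have /andP[ax ay] := active_eq xy.
have := s_repl xy yz => /= /(_ (Lab w0 (Equ x hole))).
rewrite /= /subst_var !eqxx !not_hole //.
by apply=> //; right; left.
Qed.

Let dom_eq x y w : al w -> eq_ x y -> l (Dom x w) -> l (Dom y w).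
Proof.
move=> aw /(eq_at _ _ aw) xy xw.
have := s_repl xw xy => /= /(_ (Dom hole w)).
by rewrite /= /subst_var !eqxx; apply=> //; left.
Qed.

(** [DenVar] supplies [D(y,y,w)], which [Repl] along [y = x] turns into [D(x,y,w)]. This settles a
    denotation formula with a variable on the right, which no rule decomposes. *)
Let den_eq x y w : al w -> eq_ x y -> l (Den (TVar x) y w).
Proof.
move=> aw xy; have /andP[ax ay] := active_eq xy.
have [_ yy _ _ _] := s_params ay aw.
move/eq_sym_/(eq_at _ _ aw): xy => yx.
have := s_repl yy yx => /= /(_ (Den (TVar hole) y w)).
by rewrite /= /subst_var !eqxx not_hole //; apply=> //; left.
Qed.

Let atom_eq1 (P : letter Sg) w (xs : (arity P).-tuple V) i z :
  l (Lab w (Atom P xs)) -> eq_ (tnth xs i) z ->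
  l (Lab w (Atom P [tuple if j == i then z else tnth xs j | j < _])).
Proof.
move=> Px; have aw : al w by apply: (l_lab Px); rewrite /= inE.
have ax j : av (tnth xs j) by apply: (l_fv Px); apply: mem_tnth.
move=> /(eq_at _ _ aw) xz.
have := s_repl Px xz => /= /(_ (Lab w (Atom P [tuple if j == i then hole else tnth xs j | j < _]))).
have subE u : map_tuple (subst_var u hole) [tuple if j == i then hole else tnth xs j | j < _]
            = [tuple if j == i then u else tnth xs j | j < _].
  apply: eq_from_tnth => j; rewrite tnth_map !tnth_mktuple /subst_var.
  by case: (j == i); rewrite ?eqxx // not_hole.
rewrite /= !subE; apply; rewrite ?eqxx //.
  apply: (List.in_map (fun i => Sx (Lab w (Atom P [tuple if j == i then hole else tnth xs j | j < _])))).
  by apply/inP; rewrite mem_enum.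
congr (Sx (Lab _ (Atom _ _))); apply: eq_from_tnth => j.
by rewrite tnth_mktuple; case: eqP => [->|].
Qed.

(** A template opens a single argument place, so the arguments are exchanged one by one; after [k]
    steps exactly the places below [k] have changed. *)
Let atom_eq (P : letter Sg) w (xs ys : (arity P).-tuple V) :
  (forall i, eq_ (tnth xs i) (tnth ys i)) -> l (Lab w (Atom P xs)) -> l (Lab w (Atom P ys)).
Proof.
move=> xy Px.
have H k : l (Lab w (Atom P [tuple if (j < k)%N then tnth ys j else tnth xs j | j < _])).
  elim: k => [|k IH].
    by move: Px; congr (l (Sx (Lab _ (Atom _ _)))); apply: eq_from_tnth => j; rewrite tnth_mktuple.
  have [kP|Pk] := ltnP k (arity P).
    have := @atom_eq1 _ _ _ (Ordinal kP) (tnth ys (Ordinal kP)) IH.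
    rewrite tnth_mktuple ltnn => /(_ (xy _)); congr (l (Sx (Lab _ (Atom _ _)))).
    apply: eq_from_tnth => j; rewrite !tnth_mktuple ltnS [j <= k]leq_eqVlt -val_eqE /=.
    by case: eqP => //= jk; congr (tnth ys _); apply: val_inj.
  move: IH; congr (l (Sx (Lab _ (Atom _ _)))); apply: eq_from_tnth => j; rewrite !tnth_mktuple.
  by rewrite !(leq_trans (ltn_ord j)) // (leq_trans Pk).
move: (H (arity P)); congr (l (Sx (Lab _ (Atom _ _)))).
by apply: eq_from_tnth => j; rewrite tnth_mktuple ltn_ord.
Qed.

(** Kept transparent, because the truth lemma computes with its components. *)
Definition countermodel : model Sg N.
Proof.
refine (@Model Sg N W O (fun w v => l (Rel (val w) (val v))) (fun d w => l (Dom (val d) (val w)))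
  (fun d e => eq_ (val d) (val e)) (fun P w ds => l (Lab (val w) (Atom P (map_tuple val ds))))
  _ _ _ _ _ _ _ _ _ _ _ _).
- by move=> d; apply: eq_refl (valP d).
- by move=> d e; apply: eq_sym_.
- by move=> d e f; apply: eq_trans_.
- by move=> d e w; apply: dom_eq (valP w).
- by move=> P w ds es de; apply: atom_eq => i; rewrite !tnth_map.
- by move=> n w; have [_ _ /(_ n)] := s_params x0a (valP w).
- move=> n; have ser (w : W) := let: And5 _ _ _ s _ := s_params x0a (valP w) in s n.
  have act w v : l (Rel w v) -> al v by move=> /l_lab; apply; rewrite !inE eqxx orbT.
  split=> [w|].
    by have [[v wv] _] := ser w; exists (exist _ v (act _ _ wv)).
  by have [_ [v vv]] := ser (l0 w0); exists (exist _ v (act _ _ vv)).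
- by move=> n w v u wv vu; have /= [/(_ n erefl)] := s_left2 wv vu.
- by move=> n w v u wv wu; have /= [_ /(_ n erefl)] := s_left2 wv wu.
- by move=> n d w v wv dw; have /= [/(_ n erefl)] := s_left2 dw wv.
- by move=> n d w v wv dv; have /= [_ /(_ n erefl)] := s_left2 dv wv.
- by move=> n d w; have [_ _ _ _ /(_ n)] := s_params (valP d) (valP w).
Defined.

Lemma l_alab w A : l (Lab w A) -> al w.
Proof. by move=> /l_lab; apply; rewrite /= inE. Qed.

Lemma r_alab w A : r (Lab w A) -> al w.
Proof. by move=> /r_lab; apply; rewrite /= inE. Qed.

Lemma l_aden t x w : l (Den t x w) -> al w /\ av x.
Proof. by move=> H; split; [apply: (l_lab H)|apply: (l_fv H)]; rewrite /= inE eqxx. Qed.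

Lemma r_aden t x w : r (Den t x w) -> al w /\ av x.
Proof. by move=> H; split; [apply: (r_lab H)|apply: (r_fv H)]; rewrite /= inE eqxx. Qed.

Let sM : V -> object countermodel := s0.
Let lM : L -> world countermodel := l0.

(** An object is its own name. The binders of [A] are inactive, so the active variable [val d]
    cannot be captured. *)
Lemma eval_active x A w (d : O) : (forall y, y \in bv_form A -> ~~ av y) ->
  eval (upd sM x d) w A <-> eval sM w (A<[x := val d]>).
Proof.
move=> bA; rewrite (proj2 (eval_subst countermodel _ _)); first by rewrite /sM vals0.
by apply: (proj2 (free_for_bv _ _)); apply/negP => /bA; rewrite (valP d).
Qed.

(** Terms and formulas are treated together: [Lam x A t] leads to a denotation formula for [t], and
    a description leads back to instances of its matrix. Both sides of the pair are needed at once,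
    since [Imp] and descriptions exchange them. *)
Lemma truth n :
  (forall A w, form_size A <= n ->
     (l (Lab w A) -> eval sM (lM w) A) /\ (r (Lab w A) -> ~ eval sM (lM w) A)) /\
  (forall t x w, term_size t <= n ->
     (l (Den t x w) -> den sM (lM w) t (sM x)) /\ (r (Den t x w) -> ~ den sM (lM w) t (sM x))).
Proof.
have sz (A B : nat) k : (A + B).+1 <= k.+1 -> A <= k /\ B <= k.
  by rewrite ltnS => H; split; apply: leq_trans H; rewrite ?leq_addr ?leq_addl.
elim: n => [|n [IHA IHt]]; first by split; [case|case].
have IHl A w sA := (IHA A w sA).1; have IHr A w sA := (IHA A w sA).2.
have binds A x w : form_size A <= n ->
    (forall d : O, l (Lab w (A<[x := val d]>)) -> eval (upd sM x d) (lM w) A) /\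
    (forall d : O, r (Lab w (A<[x := val d]>)) -> ~ eval (upd sM x d) (lM w) A).
  move=> sA; split=> d H; rewrite eval_active.
  - by apply: (IHl _ _ _ H); rewrite (proj2 (form_size_subst _ _)).
  - by move=> y yA; apply: (l_bv H); rewrite /= (proj2 (bv_subst _ _)).
  - by apply: (IHr _ _ _ H); rewrite (proj2 (form_size_subst _ _)).
  - by move=> y yA; apply: (r_bv H); rewrite /= (proj2 (bv_subst _ _)).
have dom_act x w : l (Dom x w) -> av x by move=> /l_fv; apply; rewrite /= inE.
have rel_act w v : l (Rel w v) -> al v by move=> /l_lab; apply; rewrite !inE eqxx orbT.
have lMK (v : W) : lM (val v) = v by apply: valKd.
split.
- case=> [P xs|x y||A B|A B|A B|x A|x A|A|A|x A t] w /= sA; split=> H.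
  + have aw := l_alab H; rewrite l0K //.
    suff -> : map_tuple val (map_tuple sM xs) = xs by [].
    by apply: eq_from_tnth => i; rewrite !tnth_map s0K // (l_fv H) //= mem_tnth.
  + have aw := r_alab H; rewrite l0K //.
    suff -> : map_tuple val (map_tuple sM xs) = xs by move/no_atom; apply.
    by apply: eq_from_tnth => i; rewrite !tnth_map s0K // (r_fv H) //= mem_tnth.
  + have aw := l_alab H; have /andP[ax ay] := active_eq H.
    by rewrite !s0K //; apply/(eq_at _ _ aw).
  + have aw := r_alab H.
    have ax : av x by apply: (r_fv H); rewrite !inE eqxx.
    have ay : av y by apply: (r_fv H); rewrite !inE eqxx orbT.
    by rewrite !s0K // => /(eq_at _ _ aw) /no_atom; apply.
  + exact: no_bot H.
  + by [].
  + have [sA1 sB1] := sz _ _ _ sA.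
    by have [/(IHl _ _ sA1) ? /(IHl _ _ sB1)] := s_left H x0a w0a.
  + have [sA1 sB1] := sz _ _ _ sA.
    by have [/(IHr _ _ sA1) ? []|/(IHr _ _ sB1) ? []] := s_right H x0a.
  + have [sA1 sB1] := sz _ _ _ sA.
    by have [/(IHl _ _ sA1)|/(IHl _ _ sB1)] := s_left H x0a w0a; [left|right].
  + have [sA1 sB1] := sz _ _ _ sA.
    by have [/(IHr _ _ sA1) ? /(IHr _ _ sB1) ?] := s_right H x0a; case.
  + have [sA1 sB1] := sz _ _ _ sA.
    by have [/(IHr _ _ sA1)|/(IHl _ _ sB1)] := s_left H x0a w0a.
  + have [sA1 sB1] := sz _ _ _ sA.
    by have [/(IHl _ _ sA1) ? /(IHr _ _ sB1) nB AB] := s_right H x0a; apply/nB/AB.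
  + move=> d; rewrite l0K ?(l_alab H) // => dw.
    by apply: (binds A x w sA).1; apply: (s_left2 dw H).
  + have [z [zw Az]] := s_right H x0a; have az := dom_act _ _ zw.
    move=> /(_ (sM z)); rewrite s0K // l0K ?(r_alab H) // => /(_ zw).
    by apply: (binds A x w sA).2; rewrite s0K.
  + have [z [zw Az]] := s_left H x0a w0a; have az := dom_act _ _ zw.
    exists (sM z); first by rewrite s0K // l0K ?(l_alab H).
    by apply: (binds A x w sA).1; rewrite s0K.
  + move=> [d]; rewrite l0K ?(r_alab H) // => dw.
    by apply: (binds A x w sA).2; apply: (s_left_right dw H).
  + move=> v; rewrite l0K ?(l_alab H) // => wv; rewrite -(lMK v).
    by apply: (IHl _ _ sA); apply: (s_left2 wv H).
  + have [u [wu Au]] := s_right H x0a; have au := rel_act _ _ wu.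
    move=> /(_ (lM u)); rewrite !l0K ?(r_alab H) // => /(_ wu).
    exact: (IHr _ _ sA).
  + have [u [wu Au]] := s_left H x0a w0a; have au := rel_act _ _ wu.
    exists (lM u); first by rewrite !l0K ?(l_alab H).
    exact: (IHl _ _ sA).
  + move=> [v]; rewrite l0K ?(r_alab H) // => wv; rewrite -(lMK v).
    by apply: (IHr _ _ sA); apply: (s_left_right wv H).
  + have [sA1 st1] := sz _ _ _ sA.
    have [z [tz Az]] := s_left H x0a w0a; have [_ az] := l_aden tz.
    exists (sM z); first exact: (IHt _ _ _ st1).1.
    by apply: (binds A x w sA1).1; rewrite s0K.
  + have [sA1 st1] := sz _ _ _ sA.
    move=> [d td Ad]; have [td'|Ad'] := s_right H (valP d).
      by apply: (IHt _ _ _ st1).2 td' _; rewrite /sM vals0.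
    exact: (binds A x w sA1).2 Ad' Ad.
- case=> [y|y A] x w /= st; split=> H.
  + have [aw ax] := l_aden H; have /= e := s_left H x0a w0a.
    by have /andP[ay _] := active_eq e; rewrite !s0K //; apply/(eq_at _ _ aw).
  + have [aw ax] := r_aden H.
    have ay : av y by apply: (r_fv H); rewrite !inE eqxx orbT.
    by rewrite !s0K // => /(den_eq aw) /no_den; apply.
  + have [aw ax] := l_aden H; split.
      have [Ax _] := s_left H x0a w0a.
      by apply: (binds A y w st).1; rewrite s0K.
    (* The [LDen2] condition is used at the variable that names [d]: its first alternative would
       make [A] false of [d], so the identity remains. *)
    move=> d Ad; have [_ [Ad'|e]] := s_left H (valP d) w0a.
      by case: ((binds A y w st).2 _ Ad').
    by rewrite s0K //; apply/(eq_at _ _ aw).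
  + have [aw ax] := r_aden H; move=> [Ax un].
    have [Ax'|[z [Az e]]] := s_right H x0a.
      by apply: (binds A y w st).2 Ax; rewrite s0K.
    have az : av z by apply: (r_fv e); rewrite !inE eqxx orbT.
    have /un : eval (upd sM y (sM z)) (lM w) A by apply: (binds A y w st).1; rewrite s0K.
    by rewrite !s0K // => /(eq_at _ _ aw) /no_atom; apply.
Qed.

Lemma countermodel_refutes S :
  (forall E, List.In E (ante S) -> l E) -> (forall F, List.In F (succ S) -> r F) ->
  refutes sM lM S.
Proof.
move=> lS rS; split; apply/all_propP => E ES.
  case: E ES => [[w A|t x w]|x w|w v] /lS H /=.
  - exact: ((truth _).1 _ _ (leqnn _)).1.
  - exact: ((truth _).2 _ _ _ (leqnn _)).1.
  - by rewrite s0K ?l0K // ?(l_fv H) ?(l_lab H) //= inE.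
  - by rewrite !l0K // (l_lab H) //= !inE eqxx ?orbT.
case: E ES => [w A|t x w] /rS H /=.
- exact: ((truth _).1 _ _ (leqnn _)).2.
- exact: ((truth _).2 _ _ _ (leqnn _)).2.
Qed.

Lemma hintikka_refutable S :
  (forall E, List.In E (ante S) -> l E) -> (forall F, List.In F (succ S) -> r F) ->
  exists (M : model Sg N) (s : V -> object M) (lb : L -> world M), refutes s lb S.
Proof. by move=> lS rS; do 3 eexists; apply: countermodel_refutes. Qed.

End Countermodel.
End Hintikka.

(** * Saturation of underivable sequents *)

Fixpoint some_prop (T : Type) (P : T -> Prop) (s : seq T) : Prop :=
  if s is a :: s' then P a \/ some_prop P s' else False.

Lemma some_propP (T : Type) (P : T -> Prop) (s : seq T) :
  some_prop P s <-> exists2 a, List.In a s & P a.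
Proof.
elim: s => [|a s IH] /=; first by split=> [|[]].
rewrite IH; split=> [[Pa|[b bs Pb]]|[b [<-|bs] Pb]]; first by exists a; [left|].
- by exists b; [right|].
- by left.
- by right; exists b.
Qed.

Section Saturate.
Context {Sg : signature} {V L : eqType} (N : nlrule -> Prop).
Hypotheses (infV : infinite V) (infL : infinite L).
Variables (B : seq V) (hole : V).
Hypothesis hole_B : hole \in B.

(** [B] is a reserve of names holding all binders and the template variable [hole]. It stays fixed,
    while the lists of variables and labels in use grow; variables in use are kept outside [B]. *)
Definition ok_form (xs : seq V) (A : form Sg V) : bool :=
  all (mem xs) (fv_form A) && all (mem B) (bv_form A).
Definition ok_term (xs : seq V) (t : term Sg V) : bool :=
  all (mem xs) (fv_term t) && all (mem B) (bv_term t).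

Definition ok (xs : seq V) (ws : seq L) (E : expr Sg V L) : bool :=
  match E with
  | Sx (Lab w A) => (w \in ws) && ok_form xs A
  | Sx (Den t x w) => [&& w \in ws, x \in xs & ok_term xs t]
  | Dom x w => (w \in ws) && (x \in xs)
  | Rel w v => (w \in ws) && (v \in ws)
  end.

Lemma ok_form_cat xs (A A1 A2 : form Sg V) :
  fv_form A = fv_form A1 ++ fv_form A2 -> bv_form A = bv_form A1 ++ bv_form A2 ->
  ok_form xs A = ok_form xs A1 && ok_form xs A2.
Proof. by rewrite /ok_form => -> ->; rewrite !all_cat andbACA. Qed.

(** [Iota x A] stands for any binder over [A]: [All x A] and [Ex x A] have the same free and bound
    variables, and [ok_lam] splits off this part of a lambda formula. *)
Lemma ok_form_subst xs xs' x y (A : form Sg V) : {subset xs <= xs'} -> y \in xs' ->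
  ok_term xs (Iota x A) -> ok_form xs' (A<[x := y]>).
Proof.
move=> sub yxs /andP[/allP /= fA /andP[_ bA]]; rewrite /ok_form (proj2 (bv_subst _ _)) bA andbT.
apply/allP => z /(proj2 (mem_fv_subst _ _ _))/orP[/eqP->//|/andP[zA zx]].
by apply/sub/fA; rewrite mem_filter zx.
Qed.

Lemma ok_form_sub xs xs' (A : form Sg V) : {subset xs <= xs'} -> ok_form xs A -> ok_form xs' A.
Proof. by move=> sub /andP[/allP fA bA]; apply/andP; split=> //; apply/allP => z /fA/sub. Qed.

Lemma ok_term_sub xs xs' (t : term Sg V) : {subset xs <= xs'} -> ok_term xs t -> ok_term xs' t.
Proof. by move=> sub /andP[/allP fA bA]; apply/andP; split=> //; apply/allP => z /fA/sub. Qed.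

Lemma ok_lam xs x A (t : term Sg V) :
  ok_form xs (Lam x A t) = ok_term xs (Iota x A) && ok_term xs t.
Proof. by rewrite /ok_form /ok_term /= !all_cat; case: (x \in B); rewrite /= ?andbF // andbACA. Qed.

Lemma ok_sub xs xs' ws ws' E : {subset xs <= xs'} -> {subset ws <= ws'} ->
  ok xs ws E -> ok xs' ws' E.
Proof.
move=> sx sw; case: E => [[w A|t x w]|x w|w v] /=.
- by case/andP => /sw-> /(ok_form_sub sx).
- by case/and3P => /sw-> /sx-> /(ok_term_sub sx).
- by case/andP => /sw-> /sx.
- by case/andP => /sw-> /sw.
Qed.

Lemma ok_fv xs ws E x : ok xs ws E -> x \in fv_expr E -> x \in xs.
Proof.
case: E => [[w A|t y w]|y w|w v] //=.
- by case/and3P=> _ /allP H _ /H.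
- by case/and3P=> _ yx /andP[/allP H _]; rewrite inE => /orP[/eqP->|/H].
- by case/andP => _ yx; rewrite inE => /eqP->.
Qed.

Lemma ok_bv xs ws E x : ok xs ws E -> x \in bv_expr E -> x \in B.
Proof.
case: E => [[w A|t y w]|y w|w v] //=.
- by case/and3P=> _ _ /allP H /H.
- by case/and4P=> _ _ _ /allP H /H.
Qed.

Lemma ok_labels xs ws E w : ok xs ws E -> w \in labels_expr E -> w \in ws.
Proof.
case: E => [[v A|t y v]|y v|u v] /=; rewrite !inE.
- by case/andP=> vs _ /eqP->.
- by case/and3P=> vs _ _ /eqP->.
- by case/andP=> vs _ /eqP->.
- by case/andP=> us vs /orP[] /eqP->.
Qed.

(* The logical rules drop most principal formulas, and neither weakening nor
   contraction is available; so a state keeps the current underivable sequent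
   together with everything seen so far. *)
Record state := State {
  seen_l : seq (expr Sg V L); seen_r : seq (sexpr Sg V L);
  cur_l : seq (expr Sg V L); cur_r : seq (sexpr Sg V L);
  vars : seq V; labs : seq L }.
Implicit Types (S : state).

(** The antecedent expressions that their rule consumes. All others are either not decomposed or
    repeated in the premisses, and so remain in the current sequent forever. *)
Definition transient_l (E : expr Sg V L) : bool :=
  match E with
  | Sx (Lab _ A) =>
    match A with And _ _ | Or _ _ | Imp _ _ | Ex _ _ | Dia _ | Lam _ _ _ => true | _ => false end
  | _ => false
  end.

Definition transient_r (F : sexpr Sg V L) : bool :=
  match F with
  | Lab _ A =>
    match A with And _ _ | Or _ _ | Imp _ _ | All _ _ | Box _ => true | _ => false end
  | Den (Iota _ _) _ _ => true
  | _ => false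
  end.

Definition in_l S E := List.In E (seen_l S).
Definition in_r S F := List.In F (seen_r S).

(** The condition is demanded for all parameters at once, because a consumed expression is no longer
    available when new variables or labels appear. *)
Definition done_l (l : expr Sg V L -> Prop) (r : sexpr Sg V L -> Prop) E :=
  transient_l E /\ forall y v, sat_left l r E y v.
Definition done_r (l : expr Sg V L -> Prop) (r : sexpr Sg V L -> Prop) F :=
  transient_r F /\ forall y, sat_right l r F y.

Record valid S : Prop := Valid {
  valid_underivable : ~ derivation N (cur_l S ⇒ cur_r S);
  valid_cur_l : forall E, List.In E (cur_l S) -> in_l S E;
  valid_cur_r : forall F, List.In F (cur_r S) -> in_r S F;
  valid_ok_l : forall E, in_l S E -> ok (vars S) (labs S) E;
  valid_ok_r : forall F, in_r S F -> ok (vars S) (labs S) F;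
  valid_vars : forall x, x \in vars S -> x \notin B;
  valid_done_l : forall E, in_l S E -> List.In E (cur_l S) \/ done_l (in_l S) (in_r S) E;
  valid_done_r : forall F, in_r S F -> List.In F (cur_r S) \/ done_r (in_l S) (in_r S) F }.

Record ext S S' : Prop := Ext {
  ext_l : forall E, in_l S E -> in_l S' E;
  ext_r : forall F, in_r S F -> in_r S' F;
  ext_vars : {subset vars S <= vars S'};
  ext_labs : {subset labs S <= labs S'} }.

Lemma ext_refl S : ext S S. Proof. by split. Qed.

Lemma ext_trans S1 S2 S3 : ext S1 S2 -> ext S2 S3 -> ext S1 S3.
Proof.
move=> [a1 b1 c1 d1] [a2 b2 c2 d2].
by split=> [E /a1/a2|F /b1/b2|x /c1/c2|w /d1/d2].
Qed.

Section Monotone.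
Variables (l l' : expr Sg V L -> Prop) (r r' : sexpr Sg V L -> Prop).
Hypotheses (ll' : forall E, l E -> l' E) (rr' : forall F, r F -> r' F).

(** [l] and [r] occur only positively in the saturation conditions, so a condition once met survives
    every extension. *)
Lemma sat_params_mono y v : sat_params N l y v -> sat_params N l' y v.
Proof.
move=> [? ? a b c]; split; try by auto.
by move=> /b[[u ?] [u' ?]]; split; [exists u|exists u']; auto.
Qed.

Lemma sat_left_mono E y v : sat_left l r E y v -> sat_left l' r' E y v.
Proof.
case: E => [[w [] //=|[] //=]|//|//]; intros; firstorder.
Qed.

Lemma sat_right_mono F y : sat_right l r F y -> sat_right l' r' F y.
Proof. by case: F => [w []|[]] //=; intros; firstorder. Qed.

Lemma sat_left2_mono E E' : sat_left2 N l E E' -> sat_left2 N l' E E'.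
Proof. by case: E => [[]|x w|w v]; case: E' => [[w' []|[]]|x' w'|w' v'] //=; intros; firstorder. Qed.

Lemma sat_repl_mono E E' : sat_repl hole l E E' -> sat_repl hole l' E E'.
Proof. by case: E' => [[w []|]||] //= x y H E1 a b c; apply/ll'/H. Qed.

Lemma sat_left_right_mono E F : sat_left_right r E F -> sat_left_right r' E F.
Proof. by case: E => [[]|x w|w v]; case: F => [w' []|[]] //=; intros; firstorder. Qed.

End Monotone.

Lemma mem_flatten_map (T : Type) (K : eqType) (s : seq T) (f : T -> seq K) x :
  x \in flatten (map f s) -> exists2 a, List.In a s & x \in f a.
Proof.
elim: s => //= a s IH; rewrite mem_cat => /orP[xa|/IH[b bs xb]]; first by exists a; [left|].
by exists b; [right|].
Qed.

Lemma valid_fv S x : valid S -> x \in fv_seq (cur_l S ⇒ cur_r S) -> x \in vars S.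
Proof.
move=> vS; rewrite mem_cat => /orP[] /mem_flatten_map[E].
  by move=> /(valid_cur_l vS)/(valid_ok_l vS)/ok_fv; apply.
by move=> /(valid_cur_r vS)/(valid_ok_r vS)/ok_fv; apply.
Qed.

Lemma valid_bv S x : valid S -> x \in bv_seq (cur_l S ⇒ cur_r S) -> x \in B.
Proof.
move=> vS; rewrite mem_cat => /orP[] /mem_flatten_map[E].
  by move=> /(valid_cur_l vS)/(valid_ok_l vS)/ok_bv; apply.
by move=> /(valid_cur_r vS)/(valid_ok_r vS)/ok_bv; apply.
Qed.

Lemma valid_labels S w : valid S -> w \in labels_seq (cur_l S ⇒ cur_r S) -> w \in labs S.
Proof.
move=> vS; rewrite mem_cat => /orP[] /mem_flatten_map[E].
  by move=> /(valid_cur_l vS)/(valid_ok_l vS)/ok_labels; apply.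
by move=> /(valid_cur_r vS)/(valid_ok_r vS)/ok_labels; apply.
Qed.

Lemma valid_pure S : valid S -> pure (cur_l S ⇒ cur_r S).
Proof.
by move=> vS x /(valid_fv vS)/(valid_vars vS); apply: contra => /(valid_bv vS).
Qed.

Lemma perm_flatten_map (T : Type) (K : eqType) (s s' : seq T) (f : T -> seq K) :
  Permutation s s' -> flatten (map f s) =i flatten (map f s').
Proof.
by elim=> //= [a t t' _ IH|a b t|t1 t2 t3 _ IH1 _ IH2] x;
  rewrite ?mem_cat ?IH1 ?IH // orbCA.
Qed.

Lemma valid_fresh_var S G D z : valid S -> Permutation (cur_l S) G -> Permutation (cur_r S) D ->
  z \notin vars S ++ B -> fresh_var z (G ⇒ D).
Proof.
move=> vS pG pD; rewrite mem_cat negb_or => /andP[zv zB].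
have /= fvE : fv_seq (cur_l S ⇒ cur_r S) =i fv_seq (G ⇒ D).
  by move=> x; rewrite /fv_seq !mem_cat (perm_flatten_map _ pG) (perm_flatten_map _ pD).
have /= bvE : bv_seq (cur_l S ⇒ cur_r S) =i bv_seq (G ⇒ D).
  by move=> x; rewrite /bv_seq !mem_cat (perm_flatten_map _ pG) (perm_flatten_map _ pD).
rewrite /fresh_var -fvE -bvE; apply/andP; split; [apply: contra zv|apply: contra zB].
  exact: valid_fv.
exact: valid_bv.
Qed.

Lemma valid_fresh_label S G D u : valid S -> Permutation (cur_l S) G -> Permutation (cur_r S) D ->
  u \notin labs S -> fresh_label u (G ⇒ D).
Proof.
move=> vS pG pD; apply: contra => uS; apply: valid_labels vS _; move: uS.
by rewrite /labels_seq !mem_cat (perm_flatten_map _ pG) (perm_flatten_map _ pD).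
Qed.

(** * Extending a state by backward rule applications *)

Definition reach S (P : state -> Prop) : Prop := exists S', [/\ valid S', ext S S' & P S'].

(** If all premisses were derivable, so would be the current sequent; an underivable premiss
    therefore becomes the next one. [Pa] and [Pb] are the principal parts, [Qs] lists what each
    premiss puts in their place, and [zs], [us] are the names added. A principal expression must
    either reappear in the premiss or be done there. *)
Lemma advance S (Pa G0 : seq (expr Sg V L)) (Pb D0 : seq (sexpr Sg V L))
    (Qs : seq (seq (expr Sg V L) * seq (sexpr Sg V L))) (zs : seq V) (us : seq L) :
  valid S -> Permutation (cur_l S) (Pa ++ G0) -> Permutation (cur_r S) (Pb ++ D0) ->
  rule N [seq (Q.1 ++ G0 ⇒ Q.2 ++ D0) | Q <- Qs] (Pa ++ G0 ⇒ Pb ++ D0) ->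
  (forall z, z \in zs -> z \notin B) ->
  all_prop (fun Q =>
    [/\ all_prop (ok (zs ++ vars S) (us ++ labs S)) Q.1,
        all_prop (fun F : sexpr Sg V L => ok (zs ++ vars S) (us ++ labs S) F) Q.2,
        all_prop (fun E => List.In E Q.1 \/
          forall l r, all_prop l Q.1 -> all_prop r Q.2 -> done_l l r E) Pa &
        all_prop (fun F => List.In F Q.2 \/
          forall l r, all_prop l Q.1 -> all_prop r Q.2 -> done_r l r F) Pb]) Qs ->
  reach S (fun S' => some_prop (fun Q => all_prop (in_l S') Q.1 /\ all_prop (in_r S') Q.2) Qs).
Proof.
move=> vS pl pr ru zB /all_propP oQ.
have [Q QQs ndQ] : exists2 Q, List.In Q Qs & ~ derivation N (Q.1 ++ G0 ⇒ Q.2 ++ D0).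
  apply: NNPP => H; apply: (valid_underivable vS); have e : seq_equiv (cur_l S ⇒ cur_r S) (Pa ++ G0 ⇒ Pb ++ D0) by [].
  apply: Derive ru e (valid_pure vS) _.
  move=> P /(List.in_map_iff _ _ _)[Q [<- QQs]]; apply: NNPP => nd; apply: H; by exists Q.
have [/all_propP ol /all_propP or /all_propP dl /all_propP dr] := oQ _ QQs.
pose S' := State (Q.1 ++ seen_l S) (Q.2 ++ seen_r S) (Q.1 ++ G0) (Q.2 ++ D0) (zs ++ vars S) (us ++ labs S).
have inQl E : List.In E Q.1 -> in_l S' E by move=> EQ; apply/List.in_app_iff; left.
have inQr F : List.In F Q.2 -> in_r S' F by move=> FQ; apply/List.in_app_iff; left.
have eS : ext S S'.
  split=> [E EE|F FF|x xx|w ww]; [apply/List.in_app_iff|apply/List.in_app_iff|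
    rewrite /= mem_cat xx orbT|rewrite /= mem_cat ww orbT] => //; by right.
have inG E : List.In E G0 -> List.In E (cur_l S).
  by move=> EG; apply: (Permutation_in _ (Permutation_sym pl)); apply/List.in_app_iff; right.
have inD F : List.In F D0 -> List.In F (cur_r S).
  by move=> EG; apply: (Permutation_in _ (Permutation_sym pr)); apply/List.in_app_iff; right.
exists S'; split=> //; last first.
  by apply/some_propP; exists Q => //; split; apply/all_propP.
split=> //=.
- move=> E /(List.in_app_iff _ _ _)[/inQl//|/inG/(valid_cur_l vS)]; exact: ext_l.
- move=> E /(List.in_app_iff _ _ _)[/inQr//|/inD/(valid_cur_r vS)]; exact: ext_r.
- move=> E /(List.in_app_iff _ _ _)[/ol//|/(valid_ok_l vS)].
  by apply: ok_sub; [exact: ext_vars eS|exact: ext_labs eS].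
- move=> E /(List.in_app_iff _ _ _)[/or//|/(valid_ok_r vS)].
  by apply: ok_sub; [exact: ext_vars eS|exact: ext_labs eS].
- by move=> x; rewrite mem_cat => /orP[/zB|/(valid_vars vS)].
- move=> E /(List.in_app_iff _ _ _)[EQ|/(valid_done_l vS)[Ec|[tE sE]]].
  + by left; apply/List.in_app_iff; left.
  + have /(List.in_app_iff _ _ _)[/dl[EQ|dE]|EG] := Permutation_in _ pl Ec.
    * by left; apply/List.in_app_iff; left.
    * by right; apply: dE; apply/all_propP.
    * by left; apply/List.in_app_iff; right.
  + by right; split=> // y v; apply: sat_left_mono (sE y v); [exact: ext_l eS|exact: ext_r eS].
- move=> F /(List.in_app_iff _ _ _)[FQ|/(valid_done_r vS)[Fc|[tF sF]]].
  + by left; apply/List.in_app_iff; left.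
  + have /(List.in_app_iff _ _ _)[/dr[FQ|dF]|FD] := Permutation_in _ pr Fc.
    * by left; apply/List.in_app_iff; left.
    * by right; apply: dF; apply/all_propP.
    * by left; apply/List.in_app_iff; right.
  + by right; split=> // y; apply: sat_right_mono (sF y); [exact: ext_l eS|exact: ext_r eS].
Qed.

Lemma reach_now S (P : state -> Prop) : valid S -> P S -> reach S P.
Proof. by move=> vS PS; exists S; split=> //; apply: ext_refl. Qed.

Lemma reach_imp S (P Q : state -> Prop) : reach S P -> (forall S', P S' -> Q S') -> reach S Q.
Proof. by move=> [S' [vS' e PS']] PQ; exists S'; split=> //; apply: PQ. Qed.

Lemma reach_bind S (P Q : state -> Prop) :
  reach S P -> (forall S', valid S' -> ext S S' -> P S' -> reach S' Q) -> reach S Q.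
Proof.
move=> [S' [vS' e PS']] /(_ S' vS' e PS')[S'' [vS'' e' QS'']].
by exists S''; split=> //; apply: ext_trans e'.
Qed.

Lemma ok_bind xs x A y : ok_term xs (Iota x A) -> y \notin B -> free_for y x A.
Proof.
move=> /andP[_ /andP[_ /allP bA]] yB; apply: (proj2 (free_for_bv _ _)).
by apply: contra yB; apply: bA.
Qed.

Lemma subset_cons (T : eqType) (z : T) (xs : seq T) : {subset xs <= z :: xs}.
Proof. by move=> x xx; rewrite inE xx orbT. Qed.

Lemma fresh_for S : exists z, z \notin vars S ++ B.
Proof. exact: infV. Qed.

Lemma reach_left S E y v : valid S -> in_l S E -> y \in vars S -> v \in labs S ->
  reach S (fun S' => sat_left (in_l S') (in_r S') E y v).
Proof.
move=> vS ES yS vlS; have oE := valid_ok_l vS ES.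
have [Ec|[_ d]] := valid_done_l vS ES; last exact: reach_now.
have [G0 pG] := in_perm Ec; have pD := Permutation_refl (cur_r S).
have yB := valid_vars vS yS.
have adv Qs zs us := @advance S [:: E] G0 [::] (cur_r S) Qs zs us vS pG pD.
have no_z (z : V) : z \in [::] -> z \notin B by [].
case: E ES oE Ec pG adv => [[w A|t x w]|x w|w u] /= ES oE Ec pG adv.
- case: A ES oE Ec pG adv => /= [P xs|x z||A1 A2|A1 A2|A1 A2|x A|x A|A|A|x A t] ES oE Ec pG adv;
    try exact: reach_now.
  + apply: reach_imp (adv [:: ([:: Sx (Lab v (Equ x z)); Sx (Lab w (Equ x z))], [::])] [::] [::]
      (RigVar _ _ _ _ _ _ _) no_z _) _; last by move=> S' /= [[[]]|].
    by split=> //; split=> //=; [move: oE => /andP[-> ->]; rewrite vlS|split=> //; left; right; left].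
  + move: oE; rewrite (@ok_form_cat _ _ A1 A2) // => /and3P[wS o1 o2].
    apply: reach_imp (adv [:: ([:: Sx (Lab w A1); Sx (Lab w A2)], [::])] [::] [::]
      (LAnd _ _ _ _ _ _) no_z _) _; last by move=> S' /= [[[? []]]|].
    split=> //; split=> //=; first by rewrite wS o1 o2.
    by split=> //; right=> l r /= [? [? _]] _.
  + move: oE; rewrite (@ok_form_cat _ _ A1 A2) // => /and3P[wS o1 o2].
    apply: reach_imp (adv [:: ([:: Sx (Lab w A1)], [::]); ([:: Sx (Lab w A2)], [::])] [::] [::]
      (LOr _ _ _ _ _ _) no_z _) _; last by move=> S' /= [[[]]|[[[]]|]] //; [left|right].
    split; [|split=> //]; split=> //=; rewrite ?wS ?o1 ?o2 //.
      by split=> //; right=> l r /= [? _] _; split=> // ? ?; left.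
    by split=> //; right=> l r /= [? _] _; split=> // ? ?; right.
  + move: oE; rewrite (@ok_form_cat _ _ A1 A2) // => /and3P[wS o1 o2].
    apply: reach_imp (adv [:: ([::], [:: Lab w A1]); ([:: Sx (Lab w A2)], [::])] [::] [::]
      (LImp _ _ _ _ _ _) no_z _) _; last by move=> S' /= [[_ []]|[[[]]|]] //; [left|right].
    split; [|split=> //]; split=> //=; rewrite ?wS ?o1 ?o2 //.
      by split=> //; right=> l r /= _ [? _]; split=> // ? ?; left.
    by split=> //; right=> l r /= [? _] _; split=> // ? ?; right.
  + have [z zf] := fresh_for S; have := zf; rewrite mem_cat negb_or => /andP[zv zB].
    move: oE => /andP[wS oA].
    have fr := valid_fresh_var vS pG pD zf.
    apply: reach_imp (adv [:: ([:: Dom z w; Sx (Lab w A<[x := z]>)], [::])] [:: z] [::]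
      (LEx _ fr) _ _) _; last by move=> S' /= [[[? []]]|] //; exists z.
      by move=> u; rewrite inE => /eqP->.
    split=> //; split=> //=.
      by rewrite wS mem_head /= (ok_form_subst (@subset_cons _ _ _) (mem_head _ _) oA).
    by split=> //; right=> l r /= [? [? _]] _; split=> // ? ?; exists z.
  + have [u uf] := infL (labs S); move: oE => /andP[wS oA].
    have fr := valid_fresh_label vS pG pD uf.
    apply: reach_imp (adv [:: ([:: Rel w u; Sx (Lab u A)], [::])] [::] [:: u]
      (LDia _ fr) no_z _) _; last by move=> S' /= [[[? []]]|] //; exists u.
    split=> //; split=> //=.
      by rewrite !inE wS eqxx orbT.
    by split=> //; right=> l r /= [? [? _]] _; split=> // ? ?; exists u.
  + have [z zf] := fresh_for S; have := zf; rewrite mem_cat negb_or => /andP[zv zB].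
    move: oE; rewrite ok_lam => /and3P[wS oA ot].
    have fr := valid_fresh_var vS pG pD zf.
    apply: reach_imp (adv [:: ([:: Sx (Den t z w); Sx (Lab w A<[x := z]>)], [::])] [:: z] [::]
      (LLam _ fr) _ _) _; last by move=> S' /= [[[? []]]|] //; exists z.
      by move=> u; rewrite inE => /eqP->.
    split=> //; split=> //=.
      by rewrite wS mem_head /= (ok_form_subst (@subset_cons _ _ _) (mem_head _ _) oA) //
        (ok_term_sub (@subset_cons _ _ _) ot).
    by split=> //; right=> l r /= [? [? _]] _; split=> // ? ?; exists z.
- case: t ES oE Ec pG adv => /= [z|z A] ES /and3P[wS xS ot] Ec pG adv.
    apply: reach_imp (adv [:: ([:: Sx (Lab w (Equ z x)); Sx (Den (TVar z) x w)], [::])] [::] [::]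
      (DenId _ _ _ _ _ _) no_z _) _; last by move=> S' /= [[[]]|].
    split=> //; split=> //=; last by split=> //; left; right; left.
    by rewrite wS xS ot /ok_form /= xS andbT; move: ot => /andP[].
  have oS S' : ext S S' -> [/\ w \in labs S', x \in vars S', y \in vars S' & ok_term (vars S') (Iota z A)].
    by move=> e; split; [exact: ext_labs e _ wS|exact: ext_vars e _ xS|exact: ext_vars e _ yS
      |exact: ok_term_sub (ext_vars e) ot].
  (* Two rules act on a description on the left. [LDen2] is applied in the state reached by [LDen1],
     where the description, being persistent, is still in the current sequent. *)
  apply: (@reach_bind _ (fun S' => in_l S' (Lab w A<[z := x]>))).
    apply: reach_imp (adv [:: ([:: Sx (Lab w A<[z := x]>); Sx (Den (Iota z A) x w)], [::])] [::] [::]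
      (LDen1 _ _ _ _ (ok_bind ot (valid_vars vS xS))) no_z _) _; last by move=> S' /= [[[]]|].
    split=> //; split=> //=; last by split=> //; left; right; left.
    by rewrite wS xS ot (ok_form_subst _ xS ot).
  move=> S' vS' e Ax; have [wS' xS' yS' ot'] := oS _ e.
  have ES' := ext_l e ES; have [{}Ec|[//]] := valid_done_l vS' ES'.
  have [{pG}G1 pG] := in_perm Ec; have {}pD := Permutation_refl (cur_r S').
  apply: reach_bind (@advance S' [:: Sx (Den (Iota z A) x w)] G1 [::] (cur_r S')
    [:: ([:: Sx (Den (Iota z A) x w)], [:: Lab w A<[z := y]>]);
        ([:: Sx (Lab w (Equ x y)); Sx (Den (Iota z A) x w)], [::])] [::] [::] vS' pG pD
      (LDen2 _ _ _ _ _ (ok_bind ot yB)) no_z _) _.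
    split; [|split=> //]; split=> //=.
    - by rewrite wS' xS' ot'.
    - by rewrite wS' (ok_form_subst _ yS' ot').
    - by split=> //; left; left.
    - by rewrite wS' xS' ot' /ok_form /= xS' yS'.
    - by split=> //; left; right; left.
  move=> S'' vS'' e' /= H; apply: reach_now => //; split; first exact: ext_l e' _ Ax.
  by case: H => [[_ []]|[[[]]|]] //; [left|right].
- exact: reach_now.
- exact: reach_now.
Qed.

Lemma reach_right S F y : valid S -> in_r S F -> y \in vars S ->
  reach S (fun S' => sat_right (in_l S') (in_r S') F y).
Proof.
move=> vS FS yS; have oF := valid_ok_r vS FS.
have [Fc|[_ d]] := valid_done_r vS FS; last exact: reach_now.
have [D0 pD] := in_perm Fc; have pG := Permutation_refl (cur_l S).
have yB := valid_vars vS yS.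
have adv Qs zs us := @advance S [::] (cur_l S) [:: F] D0 Qs zs us vS pG pD.
have no_z (z : V) : z \in [::] -> z \notin B by [].
case: F FS oF Fc pD adv => [w A|t x w] /= FS oF Fc pD adv.
- case: A FS oF Fc pD adv => /= [P xs|x z||A1 A2|A1 A2|A1 A2|x A|x A|A|A|x A t] FS oF Fc pD adv;
    try exact: reach_now.
  + move: oF; rewrite (@ok_form_cat _ _ A1 A2) // => /and3P[wS o1 o2].
    apply: reach_imp (adv [:: ([::], [:: Lab w A1]); ([::], [:: Lab w A2])] [::] [::]
      (RAnd _ _ _ _ _ _) no_z _) _; last by move=> S' /= [[_ []]|[[_ []]|]] //; [left|right].
    split; [|split=> //]; split=> //=; rewrite ?wS ?o1 ?o2 //.
      by split=> //; right=> l r /= _ [? _]; split=> // ?; left.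
    by split=> //; right=> l r /= _ [? _]; split=> // ?; right.
  + move: oF; rewrite (@ok_form_cat _ _ A1 A2) // => /and3P[wS o1 o2].
    apply: reach_imp (adv [:: ([::], [:: Lab w A1; Lab w A2])] [::] [::]
      (ROr _ _ _ _ _ _) no_z _) _; last by move=> S' /= [[_ [? []]]|].
    split=> //; split=> //=; first by rewrite wS o1 o2.
    by split=> //; right=> l r /= _ [? [? _]].
  + move: oF; rewrite (@ok_form_cat _ _ A1 A2) // => /and3P[wS o1 o2].
    apply: reach_imp (adv [:: ([:: Sx (Lab w A1)], [:: Lab w A2])] [::] [::]
      (RImp _ _ _ _ _ _) no_z _) _; last by move=> S' /= [[[? _] [? _]]|].
    split=> //; split=> //=; rewrite ?wS ?o1 ?o2 //.
    by split=> //; right=> l r /= [? _] [? _].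
  + have [z zf] := fresh_for S; have := zf; rewrite mem_cat negb_or => /andP[zv zB].
    move: oF => /andP[wS oA].
    have fr := valid_fresh_var vS pG pD zf.
    apply: reach_imp (adv [:: ([:: Dom z w], [:: Lab w A<[x := z]>])] [:: z] [::]
      (RAll _ fr) _ _) _; last by move=> S' /= [[[? _] [? _]]|] //; exists z.
      by move=> u; rewrite inE => /eqP->.
    split=> //; split=> //=; rewrite ?wS ?mem_head //=.
      by rewrite (ok_form_subst (@subset_cons _ _ _) (mem_head _ _) oA).
    by split=> //; right=> l r /= [? _] [? _]; split=> // ?; exists z.
  + have [u uf] := infL (labs S); move: oF => /andP[wS oA].
    have fr := valid_fresh_label vS pG pD uf.
    apply: reach_imp (adv [:: ([:: Rel w u], [:: Lab u A])] [::] [:: u]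
      (RBox _ fr) no_z _) _; last by move=> S' /= [[[? _] [? _]]|] //; exists u.
    split=> //; split=> //=; rewrite ?inE ?wS ?eqxx ?orbT //=.
    by split=> //; right=> l r /= [? _] [? _]; split=> // ?; exists u.
  + move: (oF); rewrite ok_lam => /and3P[wS oA ot].
    apply: reach_imp (adv [:: ([::], [:: Lab w (Lam x A t); Den t y w]);
        ([::], [:: Lab w (Lam x A t); Lab w A<[x := y]>])] [::] [::]
      (RLam _ _ _ _ _ (ok_bind oA yB)) no_z _) _;
      last by move=> S' /= [[_ [_ []]]|[[_ [_ []]]|]] //; [left|right].
    split; [|split=> //]; split=> //=; rewrite ?oF ?wS ?yS ?ot //.
    - by split=> //; left; left.
    - by rewrite (ok_form_subst _ yS oA).
    - by split=> //; left; left.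
- case: t FS oF Fc pD adv => /= [z|z A] FS /and3P[wS xS ot] Fc pD adv; first exact: reach_now.
  have [z' zf] := fresh_for S; have := zf; rewrite mem_cat negb_or => /andP[zv zB].
  have fr := valid_fresh_var vS pG pD zf.
  apply: reach_imp (adv [:: ([::], [:: Lab w A<[z := x]>]);
      ([:: Sx (Lab w A<[z := z']>)], [:: Lab w (Equ x z')])] [:: z'] [::]
    (RDen _ (ok_bind ot (valid_vars vS xS)) fr) _ _) _; last first.
  + by move=> S' /= [[_ []]|[[[? _] [? _]]|]] //; [left|right; exists z'].
  + split; [|split=> //]; split=> //=; rewrite ?wS //=.
    * by rewrite (ok_form_subst (@subset_cons _ _ _) _ ot) // inE xS orbT.
    * by split=> //; right=> l r /= _ [? _]; split=> // ?; left.
    * by rewrite (ok_form_subst (@subset_cons _ _ _) (mem_head _ _) ot).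
    * by rewrite /ok_form /= !inE xS eqxx orbT.
    * by split=> //; right=> l r /= [? _] [? _]; split=> // ?; right; exists z'.
  + by move=> u; rewrite inE => /eqP->.
Qed.

Definition ext_stable (P : state -> Prop) : Prop := forall S S', ext S S' -> P S -> P S'.

Lemma reach_and S (P Q : state -> Prop) : ext_stable P -> reach S P ->
  (forall S', valid S' -> ext S S' -> reach S' Q) -> reach S (fun S' => P S' /\ Q S').
Proof.
move=> mP rP rQ; apply: reach_bind rP _ => S' vS' e PS'.
have [S'' [vS'' e' QS'']] := rQ _ vS' e.
by exists S''; split=> //; split=> //; apply: mP PS'.
Qed.

Lemma reach_if S (C : Prop) (P : state -> Prop) : valid S -> (C -> reach S P) ->
  reach S (fun S' => C -> P S').
Proof.
move=> vS rP; have [/rP r|nC] := classic C; last exact: reach_now.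
by apply: reach_imp r _ => S' ? _.
Qed.

Lemma mono_all (T : Type) (s : seq T) (P : T -> state -> Prop) :
  (forall a, ext_stable (P a)) -> ext_stable (fun S' => forall a, List.In a s -> P a S').
Proof. by move=> mP S1 S2 e H a a_s; apply: mP e (H a a_s). Qed.

(** Finitely many obligations are met in succession; stability keeps the earlier ones while the
    later ones are treated. *)
Lemma reach_all (T : Type) (s : seq T) (P : T -> state -> Prop) S :
  valid S -> (forall a, ext_stable (P a)) ->
  (forall a S', List.In a s -> valid S' -> ext S S' -> reach S' (P a)) ->
  reach S (fun S' => forall a, List.In a s -> P a S').
Proof.
move=> vS mP; elim: s S vS => [|a s IH] S vS rP; first exact: reach_now.
have ra : reach S (P a) by apply: rP => //; [left|apply: ext_refl].
apply: reach_imp (reach_and (Q := fun S' => forall b, List.In b s -> P b S') (mP a) ra _) _.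
  move=> S' vS' e; apply: IH => // b S'' bs vS'' e'.
  by apply: rP => //; [right|apply: ext_trans e'].
by move=> S' [Pa Ps] b [<-|/Ps].
Qed.

Lemma reach_add S E zs us : valid S -> (forall z, z \in zs -> z \notin B) ->
  ok (zs ++ vars S) (us ++ labs S) E ->
  rule N [:: E :: cur_l S ⇒ cur_r S] (cur_l S ⇒ cur_r S) -> reach S (in_l^~ E).
Proof.
move=> vS zB oE ru.
apply: reach_imp (@advance S [::] (cur_l S) [::] (cur_r S) [:: ([:: E], [::])] zs us
  vS (Permutation_refl _) (Permutation_refl _) ru zB _) _; last by move=> S' /= [[[]]|].
by split.
Qed.

Lemma persistent_l S E : valid S -> in_l S E -> ~~ transient_l E -> List.In E (cur_l S).
Proof. by move=> vS /(valid_done_l vS)[//|[->]]. Qed.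

Lemma persistent_r S F : valid S -> in_r S F -> ~~ transient_r F -> List.In F (cur_r S).
Proof. by move=> vS /(valid_done_r vS)[//|[->]]. Qed.

(** The rules with two principal antecedent expressions. Were [E1] and [E2] equal, two occurrences
    would be required where only one is known to exist; wherever this can happen, the calling lemma
    treats it separately. *)
Lemma reach_add2 S E1 E2 E : valid S -> in_l S E1 -> in_l S E2 ->
  ~~ transient_l E1 -> ~~ transient_l E2 -> E1 <> E2 -> ok (vars S) (labs S) E ->
  (forall G D, rule N [:: [:: E, E1, E2 & G] ⇒ D] ([:: E1, E2 & G] ⇒ D)) -> reach S (in_l^~ E).
Proof.
move=> vS S1 S2 t1 t2 n12 oE ru.
have [G0 pG] := in_perm2 n12 (persistent_l vS S1 t1) (persistent_l vS S2 t2).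
apply: reach_imp (@advance S [:: E1; E2] G0 [::] (cur_r S) [:: ([:: E; E1; E2], [::])] [::] [::]
  vS pG (Permutation_refl _) (ru _ _) _ _) _ => //; last by move=> S' /= [[[]]|].
split=> //; split=> //=; last by split; [|split=> //]; left; [right; left|right; right; left].
by rewrite oE (valid_ok_l vS S1) (valid_ok_l vS S2).
Qed.

Lemma reach_params S y v : valid S -> y \in vars S -> v \in labs S ->
  reach S (fun S' => sat_params N (in_l S') y v).
Proof.
move=> vS yS vlS.
have no_z (z : V) : z \in [::] -> z \notin B by [].
have mem S' : ext S S' -> (y \in vars S') * (v \in labs S').
  by move=> e; split; [exact: ext_vars e _ yS|exact: ext_labs e _ vlS].
have eq_step S' : valid S' -> ext S S' -> reach S' (in_l^~ (Sx (Lab v (Equ y y)))).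
  move=> vS' /mem m; apply: (@reach_add S' _ [::] [::]) => //; last exact: RefEq.
  by rewrite /= m /ok_form /= m.
have den_step S' : valid S' -> ext S S' -> reach S' (in_l^~ (Sx (Den (TVar y) y v))).
  move=> vS' /mem m; apply: (@reach_add S' _ [::] [::]) => //; last exact: DenVar.
  by rewrite /= !m /ok_term /= m.
have ref_step S' : valid S' -> ext S S' -> reach S' (fun S' => N NRef -> in_l S' (Rel v v)).
  move=> vS' /mem m; apply: reach_if => // n.
  by apply: (@reach_add S' _ [::] [::]) => //; [rewrite /= m|exact: Ref_rule].
have cons_step S' : valid S' -> ext S S' -> reach S' (fun S' => N NCons -> in_l S' (Dom y v)).
  move=> vS' /mem m; apply: reach_if => // n.
  by apply: (@reach_add S' _ [::] [::]) => //; [rewrite /= !m|exact: Cons_rule].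
have ser_step S' : valid S' -> ext S S' ->
    reach S' (fun S' => N NSer -> exists u, in_l S' (Rel v u)).
  move=> vS' /mem m; apply: reach_if => // n; have [u uf] := infL (labs S').
  have fr := valid_fresh_label vS' (Permutation_refl _) (Permutation_refl _) uf.
  apply: reach_imp (@reach_add S' (Rel v u) [::] [:: u] vS' no_z _ _) _; last by exists u.
    by rewrite /= !inE m eqxx orbT.
  exact: Ser_rule.
(* The instance of [Ser] in which both labels are the fresh one. *)
have refl_step S' : valid S' -> ext S S' ->
    reach S' (fun S' => N NSer -> exists u, in_l S' (Rel u u)).
  move=> vS' _; apply: reach_if => // n; have [u uf] := infL (labs S').
  have fr := valid_fresh_label vS' (Permutation_refl _) (Permutation_refl _) uf.
  apply: reach_imp (@reach_add S' (Rel u u) [::] [:: u] vS' no_z _ _) _; last by exists u.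
    by rewrite /= !inE eqxx.
  exact: Ser_rule.
apply: reach_bind (eq_step _ vS (ext_refl _)) _ => S1 v1 e1 h1.
apply: reach_bind (den_step _ v1 e1) _ => S2 v2 e2 h2; have e02 := ext_trans e1 e2.
apply: reach_bind (ref_step _ v2 e02) _ => S3 v3 e3 h3; have e03 := ext_trans e02 e3.
apply: reach_bind (cons_step _ v3 e03) _ => S4 v4 e4 h4; have e04 := ext_trans e03 e4.
apply: reach_bind (ser_step _ v4 e04) _ => S5 v5 e5 h5; have e05 := ext_trans e04 e5.
apply: reach_bind (refl_step _ v5 e05) _ => S6 v6 e6 h6.
have e36 := ext_trans e4 (ext_trans e5 e6); have e26 := ext_trans e3 e36.
apply: reach_now => //; split.
- exact: ext_l (ext_trans e2 e26) _ h1.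
- exact: ext_l e26 _ h2.
- by move=> n; apply: ext_l e36 _ (h3 n).
- by move=> n; split; [have [u h] := h5 n; exists u; apply: ext_l e6 _ h|apply: h6].
- by move=> n; apply: ext_l (ext_trans e5 e6) _ (h4 n).
Qed.

Lemma reach_left2 S E1 E2 : valid S -> in_l S E1 -> in_l S E2 ->
  reach S (fun S' => sat_left2 N (in_l S') E1 E2).
Proof.
move=> vS S1 S2; have := valid_ok_l vS S1; have := valid_ok_l vS S2.
case: E1 S1 => [F|x w|w v] S1; first by move=> *; exact: reach_now.
- case: E2 S2 => [[w' A|t y w']|y w'|w' v'] S2 /= o2 o1; try exact: reach_now.
    case: A S2 o2 => //=; try by move=> *; exact: reach_now.
    move=> y A S2 o2.
    case/andP: o1 => wS xS; have xB := valid_vars vS xS; case/andP: o2 => _ oA.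
    have [e|ne] := w =P w'; last exact: reach_now.
    subst w'; apply: reach_imp (reach_add2 (E := Lab w (A<[y := x]>)) vS S1 S2 _ _ _ _ _) _ => //.
    + by rewrite /= wS (ok_form_subst _ xS oA).
    + by move=> G D; apply: LAll; apply: ok_bind oA xB.
  case/andP: o1 => wS xS; case/andP: o2 => wS' vS'.
  apply: reach_and.
  + by move=> S0 S' e H n we; apply: ext_l e _ (H n we).
  + apply: reach_if => // n; have [e|ne] := w =P w'; last exact: reach_now.
    subst w'; apply: reach_imp (reach_add2 (E := Dom x v') vS S1 S2 _ _ _ _ _) _ => //=.
      by rewrite vS' xS.
    by move=> G D; apply: Incr_rule.
  + move=> S' vvS' e; apply: reach_if => // n; have [ee|ne] := w =P v'; last exact: reach_now.
    subst v'; apply: reach_imp (reach_add2 (E := Dom x w') vvS' (ext_l e S1) (ext_l e S2) _ _ _ _ _) _ => //=.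
      by rewrite (ext_labs e wS') (ext_vars e xS).
    by move=> G D; apply: Decr_rule.
- case: E2 S2 => [[w' A|t y w']|y w'|w' v'] S2 /= o2 o1; try exact: reach_now.
    case: A S2 o2 => //=; try by move=> *; exact: reach_now.
    move=> A S2 o2.
    case/andP: o1 => wS vlS; case/andP: o2 => _ oA.
    have [e|ne] := w =P w'; last exact: reach_now.
    subst w'; apply: reach_imp (reach_add2 (E := Lab v A) vS S1 S2 _ _ _ _ _) _ => //.
    + by rewrite /= vlS.
    + by move=> G D; apply: LBox.
  case/andP: o1 => wS vlS; case/andP: o2 => wS' vS'.
  apply: reach_and.
  + by move=> S0 S' e H n we; apply: ext_l e _ (H n we).
  + apply: reach_if => // n; have [e|ne] := v =P w'; last exact: reach_now.
    (* If the two atoms coincide, the atom demanded is that same atom. *)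
    subst w'; have [[ev ew]|ne] := classic (Rel w v = Rel v v' :> expr Sg V L).
      by subst; apply: reach_now.
    apply: reach_imp (reach_add2 (E := Rel w v') vS S1 S2 _ _ _ _ _) _ => //=.
      by rewrite wS vS'.
    by move=> G D; apply: Trans_rule.
  + move=> S' vvS' e; apply: reach_if => // n; have [ee|ne] := w =P w'; last exact: reach_now.
    subst w'; have ewl u : u \in labs S -> u \in labs S' by move=> uu; apply: (ext_labs e).
    (* If the two atoms coincide, the atom demanded is a loop at [v], which is exactly what the
       contracted rule [EuclC_rule] adds. *)
    have [[ev]|ne] := classic (Rel w v = Rel w v' :> expr Sg V L).
      subst v'; have [G0 pG] := in_perm (persistent_l vvS' (ext_l e S1) isT).
      apply: reach_imp (@advance S' [:: Rel w v] G0 [::] (cur_r S') [:: ([:: Rel v v; Rel w v], [::])]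
        [::] [::] vvS' pG (Permutation_refl _) (EuclC_rule _ _ _ _ n) _ _) _ => //.
        split=> //; split=> //=; first by rewrite !ewl.
        by split=> //; left; right; left.
      by move=> S'' /= [[[]]|].
    apply: reach_imp (reach_add2 (E := Rel v v') vvS' (ext_l e S1) (ext_l e S2) _ _ _ _ _) _ => //=.
      by rewrite !ewl.
    by move=> G D; apply: Eucl_rule.
Qed.

Lemma reach_left_right S E F : valid S -> in_l S E -> in_r S F ->
  reach S (fun S' => sat_left_right (in_r S') E F).
Proof.
move=> vS SE SF; have oE := valid_ok_l vS SE; have oF := valid_ok_r vS SF.
have add A w : ~~ transient_l E -> ~~ transient_r F -> ok (vars S) (labs S) (Lab w A) ->
    (forall G D, rule N [:: E :: G ⇒ [:: F, Lab w A & D]] (E :: G ⇒ F :: D)) ->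
    reach S (in_r^~ (Lab w A)).
  move=> tE tF oA ru.
  have [G0 pG] := in_perm (persistent_l vS SE tE).
  have [D0 pD] := in_perm (persistent_r vS SF tF).
  apply: reach_imp (@advance S [:: E] G0 [:: F] D0 [:: ([:: E], [:: F; Lab w A])] [::] [::]
    vS pG pD (ru _ _) _ _) _ => //; last by move=> S' /= [[_ [_ []]]|].
  split=> //; split=> //=.
  - by split=> //; left; left.
  - by split=> //; left; left.
case: E SE oE add => [E|x w|w v] SE oE add; first exact: reach_now.
- case: F SF oF add => [w' A|t y w'] SF oF add; last exact: reach_now.
  case: A SF oF add => //=; try by move=> *; exact: reach_now.
  move=> y A SF /andP[_ oA] add; have [e|ne] := w =P w'; last exact: reach_now.
  subst w'; move: oE => /andP[wS xS].
  apply: reach_imp (add (A<[y := x]>) w isT isT _ _) _ => //.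
    by rewrite /= wS (ok_form_subst _ xS oA).
  by move=> G D; apply: REx; apply: ok_bind oA (valid_vars vS xS).
- case: F SF oF add => [w' A|t y w'] SF oF add; last exact: reach_now.
  case: A SF oF add => //=; try by move=> *; exact: reach_now.
  move=> A SF /andP[_ oA] add; have [e|ne] := w =P w'; last exact: reach_now.
  subst w'; move: oE => /andP[wS vlS].
  apply: reach_imp (add A v isT isT _ _) _ => //.
    by rewrite /= vlS.
  by move=> G D; apply: RDia.
Qed.

Lemma replaceable_persistent w E y : replaceable w E -> ~~ transient_l (subst_expr y hole E).
Proof. by case: E => [[v []|[]]|x v|v u] //=; rewrite andbF. Qed.

Lemma ok_replace xs ws w E y z : replaceable w E -> z \in xs ->
  ok xs ws (subst_expr y hole E) -> ok xs ws (subst_expr z hole E).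
Proof.
move=> rE zxs.
have var u : subst_var y hole u \in xs -> subst_var z hole u \in xs.
  by rewrite /subst_var; case: ifP.
case: E rE => [[v A|[u|//] x v]|x v|//] /= rE.
- case: A rE => [P us|u1 u2|||||||||]; rewrite /= ?andbF // /ok_form => _ /and3P[-> /allP aus _] /=.
    rewrite andbT; apply/allP => _ /mapP[u uus ->]; apply/var/aus.
    by apply/mapP; exists u.
  by rewrite !var //; apply: aus; rewrite !inE eqxx ?orbT.
- by rewrite /ok_term /= !andbT => /and3P[-> /var-> /var->].
- by case/andP=> -> /var.
Qed.

Lemma reach_repl S E1 E2 : valid S -> in_l S E1 -> in_l S E2 ->
  reach S (fun S' => sat_repl hole (in_l S') E1 E2).
Proof.
move=> vS S1 S2; have o1 := valid_ok_l vS S1; have o2 := valid_ok_l vS S2.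
case: E2 S2 o2 => [[w A|t x w]|x w|w v] S2 o2; try exact: reach_now.
case: A S2 o2 => [P xs|y z||A1 A2|A1 A2|A1 A2|x A|x A|A|A|x A t] S2 o2; try exact: reach_now.
move: o2 => /andP[wS /andP[/allP yzS _]].
have zS : z \in vars S by apply: yzS; rewrite !inE eqxx orbT.
apply: (reach_imp (reach_all (s := templates hole E1) (P := fun E S' => replaceable w E ->
  subst_expr y hole E = E1 -> in_l S' (subst_expr z hole E)) vS _ _)).
- by move=> E S1' S2' e H rE eE; apply: ext_l e _ (H rE eE).
- move=> E S' _ vS' e; apply: reach_if => // rE; apply: reach_if => // eE.
  have o1' : ok (vars S') (labs S') (subst_expr z hole E).
    by apply: (ok_replace (y := y) rE (ext_vars e zS)); rewrite eE; apply: (valid_ok_l vS'); apply: ext_l e _ S1.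
  have [E12|n12] := classic (E1 = Sx (Lab w (Equ y z))); last first.
    apply: reach_imp (reach_add2 (E := subst_expr z hole E) vS' (ext_l e S1) (ext_l e S2) _ _ n12 o1' _) _ => //.
      by rewrite -eE; apply: replaceable_persistent rE.
    by move=> G D; rewrite -eE; apply: Repl.
  (* Both principal formulas of [Repl] are then the same occurrence: the new
     formula is either y = z again or z = z. *)
  have [E'|E'] : subst_expr z hole E = Sx (Lab w (Equ z z)) \/
      subst_expr z hole E = Sx (Lab w (Equ y z)).
    move: eE; rewrite E12; case: (E) => [[v []|]||] //= a b [->]; rewrite /subst_var.
    by case: (a == hole); case: (b == hole) => ya zb; (left; congruence) || (right; congruence).
  + rewrite E'; apply: (@reach_add S' _ [::] [::]) => //; last exact: RefEq.
    by rewrite -E'.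
  + by rewrite E'; apply: reach_now => //; apply: ext_l e _ S2.
- by move=> S' H E EE rE eE; apply: H.
Qed.

(** * Fair rounds and their limit *)

Definition saturated_by S S' : Prop :=
  (forall y, List.In y (vars S) -> forall v, List.In v (labs S) -> sat_params N (in_l S') y v) /\
  (forall E, in_l S E -> forall y, List.In y (vars S) -> forall v, List.In v (labs S) ->
     sat_left (in_l S') (in_r S') E y v) /\
  (forall F, in_r S F -> forall y, List.In y (vars S) -> sat_right (in_l S') (in_r S') F y) /\
  (forall E, in_l S E -> forall E', in_l S E' -> sat_left2 N (in_l S') E E') /\
  (forall E, in_l S E -> forall E', in_l S E' -> sat_repl hole (in_l S') E E') /\
  (forall E, in_l S E -> forall F, in_r S F -> sat_left_right (in_r S') E F).

(** Only what [S] itself has seen is treated, which is finite; obligations created on the way are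
    left to the next round. *)
Lemma reach_closed S : valid S -> reach S (saturated_by S).
Proof.
move=> vS.
have m1 y v : ext_stable (fun S' => sat_params N (in_l S') y v).
  by move=> S1 S2 e; apply: sat_params_mono; apply: ext_l.
have m2 E y v : ext_stable (fun S' => sat_left (in_l S') (in_r S') E y v).
  by move=> S1 S2 e; apply: sat_left_mono; [apply: ext_l|apply: ext_r].
have m3 F y : ext_stable (fun S' => sat_right (in_l S') (in_r S') F y).
  by move=> S1 S2 e; apply: sat_right_mono; [apply: ext_l|apply: ext_r].
have m4 E E' : ext_stable (fun S' => sat_left2 N (in_l S') E E').
  by move=> S1 S2 e; apply: sat_left2_mono; apply: ext_l.
have m5 E E' : ext_stable (fun S' => sat_repl hole (in_l S') E E').
  by move=> S1 S2 e; apply: sat_repl_mono; apply: ext_l.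
have m6 E F : ext_stable (fun S' => sat_left_right (in_r S') E F).
  by move=> S1 S2 e; apply: sat_left_right_mono; apply: ext_r.
have iv y S' : ext S S' -> List.In y (vars S) -> y \in vars S'.
  by move=> e /inP yS; apply: ext_vars e _ yS.
have il v S' : ext S S' -> List.In v (labs S) -> v \in labs S'.
  by move=> e /inP yS; apply: ext_labs e _ yS.
apply: reach_and; [by do 2 apply: mono_all => ?| |move=> {}S1 v1 e1].
  apply: reach_all => // [?|y S1 yS v1 e1]; first exact: mono_all.
  apply: reach_all => // v S2 vlS v2 e2; have e := ext_trans e1 e2.
  by apply: reach_params => //; [apply: iv|apply: il].
apply: reach_and; [by do 3 apply: mono_all => ?| |move=> {}S2 v2 e2].
  apply: reach_all => // [?|E S2 ES v2 e2]; first by do 2 apply: mono_all => ?.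
  apply: reach_all => // [?|y S3 yS v3 e3]; first exact: mono_all.
  apply: reach_all => // v S4 vlS v4 e4.
  have e24 := ext_trans e2 (ext_trans e3 e4); have e := ext_trans e1 e24.
  by apply: reach_left => //; [apply: ext_l e _ ES|apply: iv|apply: il].
have {e1 e2}e2 := ext_trans e1 e2.
apply: reach_and; [by do 2 apply: mono_all => ?| |move=> {}S3 v3 e3].
  apply: reach_all => // [?|F S3 FS v3 e3]; first exact: mono_all.
  apply: reach_all => // y S4 yS v4 e4; have e := ext_trans e2 (ext_trans e3 e4).
  by apply: reach_right => //; [apply: ext_r e _ FS|apply: iv].
have {e2 e3}e3 := ext_trans e2 e3.
apply: reach_and; [by do 2 apply: mono_all => ?| |move=> {}S4 v4 e4].
  apply: reach_all => // [?|E S4 ES v4 e4]; first exact: mono_all.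
  apply: reach_all => // E' S5 ES' v5 e5; have e := ext_trans e3 (ext_trans e4 e5).
  by apply: reach_left2 => //; apply: ext_l e _ _.
have {e3 e4}e4 := ext_trans e3 e4.
apply: reach_and; [by do 2 apply: mono_all => ?| |move=> {}S5 v5 e5].
  apply: reach_all => // [?|E S5 ES v5 e5]; first exact: mono_all.
  apply: reach_all => // E' S6 ES' v6 e6; have e := ext_trans e4 (ext_trans e5 e6).
  by apply: reach_repl => //; apply: ext_l e _ _.
have {e4 e5}e5 := ext_trans e4 e5.
apply: reach_all => // [?|E S6 ES v6 e6]; first exact: mono_all.
apply: reach_all => // F S7 FS v7 e7; have e := ext_trans e5 (ext_trans e6 e7).
by apply: reach_left_right => //; [apply: ext_l e _ ES|apply: ext_r e _ FS].
Qed.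

Lemma ok_intro xs ws E : {subset fv_expr E <= xs} -> {subset bv_expr E <= B} ->
  {subset labels_expr E <= ws} -> ok xs ws E.
Proof.
move=> fE bE lE; case: E fE bE lE => [[w A|t x w]|x w|w v] /= fE bE lE.
- by rewrite lE ?inE //=; apply/andP; split; apply/allP => z; [apply: fE|apply: bE].
- rewrite lE ?inE // fE ?mem_head //=; apply/andP; split; apply/allP => z zt; last exact: bE.
  by apply: fE; rewrite inE zt orbT.
- by rewrite lE ?fE ?inE.
- by rewrite !lE ?inE ?eqxx ?orbT.
Qed.

(** Such expressions are never consumed, so one seen on both sides is still on both sides of the
    current sequent, even if it entered them at different times; that sequent would be initial. *)
Lemma valid_consistent S (F : sexpr Sg V L) : valid S -> in_l S F -> in_r S F ->
  ~~ (match F with Lab _ A => is_atom A | Den (TVar _) _ _ => true | _ => false end).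
Proof.
move=> vS Fl Fr; apply/negP => at_.
have tl : ~~ transient_l F by case: F at_ {Fl Fr} => [w []|[]].
have tr : ~~ transient_r F by case: F at_ {Fl Fr tl} => [w []|[]].
have [G0 pG] := in_perm (persistent_l vS Fl tl).
have [D0 pD] := in_perm (persistent_r vS Fr tr).
have ini : rule N [::] (Sx F :: G0 ⇒ F :: D0).
  by case: F at_ {Fl Fr tl tr pG pD} => [w A|[y|//] x w] /= at_; constructor.
have e : seq_equiv (cur_l S ⇒ cur_r S) (Sx F :: G0 ⇒ F :: D0) by [].
by apply: (valid_underivable vS); apply: Derive ini e (valid_pure vS) _.
Qed.

Lemma valid_no_bot S w : valid S -> ~ in_l S (Lab w Bot).
Proof.
move=> vS Fl; have [G0 pG] := in_perm (persistent_l vS Fl isT).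
have e : seq_equiv (cur_l S ⇒ cur_r S) (Sx (Lab w Bot) :: G0 ⇒ cur_r S) by [].
apply: (valid_underivable vS); apply: Derive (InitBot _ _ _ _) e (valid_pure vS) _.
by [].
Qed.

(** Being active in the limit is an unbounded existence statement, whereas the carriers of the
    countermodel are subtypes cut out by boolean predicates. *)
Definition asbool (P : Prop) : bool := if excluded_middle_informative P then true else false.

Lemma asboolP (P : Prop) : reflect P (asbool P).
Proof. by rewrite /asbool; case: excluded_middle_informative => p; constructor. Qed.

(** The pair is the union of all rounds. An obligation involves finitely many members; all are
    present at the maximum of their stages, the next round meets it, and monotonicity carries it to
    the limit. *)
Lemma valid_refutable S x0 w0 : valid S -> x0 \in vars S -> w0 \in labs S ->
  exists (M : model Sg N) (s : V -> object M) (l : L -> world M),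
    refutes s l (seen_l S ⇒ seen_r S).
Proof.
move=> vS x0S w0S.
have next (T : {S | valid S}) :
    exists T' : {S | valid S}, ext (sval T) (sval T') /\ saturated_by (sval T) (sval T').
  case: T => T vT; have [T' [vT' e c]] := reach_closed vT.
  by exists (exist _ T' vT').
pose f T := sval (constructive_indefinite_description _ (next T)).
have fP T : ext (sval T) (sval (f T)) /\ saturated_by (sval T) (sval (f T)).
  by rewrite /f; case: constructive_indefinite_description.
pose st n := sval (iter n f (exist _ S vS)).
have st_valid n : valid (st n) by rewrite /st; case: (iter n f _).
have st_closed n : saturated_by (st n) (st n.+1) by have [] := fP (iter n f (exist _ S vS)).
have st_ext n k : ext (st n) (st (k + n)).
  elim: k => [|k IH]; first exact: ext_refl.
  by apply: ext_trans IH _; have [] := fP (iter (k + n) f (exist _ S vS)).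
have st_le n m : n <= m -> ext (st n) (st m) by move=> /subnK <-.
pose l E := exists n, in_l (st n) E.
pose r F := exists n, in_r (st n) F.
pose av x := asbool (exists n, x \in vars (st n)).
pose al w := asbool (exists n, w \in labs (st n)).
have lim_l n E : in_l (st n) E -> l E by exists n.
have lim_r n F : in_r (st n) F -> r F by exists n.
have up_l n m E : n <= m -> in_l (st n) E -> in_l (st m) E by move=> /st_le/ext_l; apply.
have up_r n m F : n <= m -> in_r (st n) F -> in_r (st m) F by move=> /st_le/ext_r; apply.
have up_v n m x : n <= m -> x \in vars (st n) -> List.In x (vars (st m)).
  by move=> /st_le/ext_vars H /H/inP.
have up_w n m w : n <= m -> w \in labs (st n) -> List.In w (labs (st m)).
  by move=> /st_le/ext_labs H /H/inP.
have av0 : av x0 by apply/asboolP; exists 0.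
have al0 : al w0 by apply/asboolP; exists 0.
have avB x : x \in B -> ~~ av x.
  by move=> xB; apply/asboolP => -[n /(valid_vars (st_valid n))]; rewrite xB.
apply: (@hintikka_refutable Sg V L N hole l r av al x0 w0 av0 al0 (avB _ hole_B)).
- by move=> E x [n En] xE; apply/asboolP; exists n; apply: ok_fv (valid_ok_l (st_valid n) En) xE.
- by move=> E x [n En] xE; apply/avB/(ok_bv (valid_ok_l (st_valid n) En) xE).
- by move=> E w [n En] wE; apply/asboolP; exists n; apply: ok_labels (valid_ok_l (st_valid n) En) wE.
- by move=> E x [n En] xE; apply/asboolP; exists n; apply: ok_fv (valid_ok_r (st_valid n) En) xE.
- by move=> E x [n En] xE; apply/avB/(ok_bv (valid_ok_r (st_valid n) En) xE).
- by move=> E w [n En] wE; apply/asboolP; exists n; apply: ok_labels (valid_ok_r (st_valid n) En) wE.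
- move=> y v /asboolP[n yn] /asboolP[m vm].
  have [c _] := st_closed (maxn n m); apply: (sat_params_mono (lim_l _)).
  by apply: c; [apply: up_v yn; apply: leq_maxl|apply: up_w vm; apply: leq_maxr].
- move=> E y v [k Ek] /asboolP[n yn] /asboolP[m vm].
  have [_ [c _]] := st_closed (maxn k (maxn n m)); apply: (sat_left_mono (lim_l _) (lim_r _)).
  apply: c; [apply: up_l Ek|apply: up_v yn|apply: up_w vm]; by rewrite !leq_max leqnn ?orbT.
- move=> F y [k Fk] /asboolP[n yn].
  have [_ [_ [c _]]] := st_closed (maxn k n); apply: (sat_right_mono (lim_l _) (lim_r _)).
  apply: c; [apply: up_r Fk|apply: up_v yn]; by rewrite !leq_max leqnn ?orbT.
- move=> E E' [k Ek] [n En].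
  have [_ [_ [_ [c _]]]] := st_closed (maxn k n); apply: (sat_left2_mono (lim_l _)).
  apply: c; [apply: up_l Ek|apply: up_l En]; by rewrite !leq_max leqnn ?orbT.
- move=> E E' [k Ek] [n En].
  have [_ [_ [_ [_ [c _]]]]] := st_closed (maxn k n); apply: (sat_repl_mono (lim_l _)).
  apply: c; [apply: up_l Ek|apply: up_l En]; by rewrite !leq_max leqnn ?orbT.
- move=> E F [k Ek] [n Fn].
  have [_ [_ [_ [_ [_ c]]]]] := st_closed (maxn k n); apply: (sat_left_right_mono (lim_r _)).
  apply: c; [apply: up_l Ek|apply: up_r Fn]; by rewrite !leq_max leqnn ?orbT.
- move=> w p at_ [n ln] [m rm].
  have := valid_consistent (st_valid (maxn n m)) (up_l _ _ _ (leq_maxl _ _) ln) (up_r _ _ _ (leq_maxr _ _) rm).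
  by rewrite at_.
- move=> x y w [n ln] [m rm].
  by have := valid_consistent (st_valid (maxn n m)) (up_l _ _ _ (leq_maxl _ _) ln) (up_r _ _ _ (leq_maxr _ _) rm).
- by move=> w [n /(valid_no_bot (st_valid n))].
- by move=> E ES; exists 0.
- by move=> F FS; exists 0.
Qed.

End Saturate.

(** * Renaming of binders, completeness and cut *)

Section Renaming.
Context {Sg : signature} {V L : eqType}.
Hypothesis infV : infinite V.

(** The only variable that [e] can pair with [x]. It really is a partner unless an inner binder on
    the right captures it, whence the hypothesis on free variables in [alpha_avoid]. *)
Fixpoint alpha_image (e : seq (V * V)) (x : V) : V :=
  if e is (a, b) :: e' then if x == a then b else alpha_image e' x else x.

Lemma mem_alpha_image e x : (alpha_image e x == x) || (alpha_image e x \in unzip2 e).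
Proof.
elim: e => [|[a b] e IH] /=; first by rewrite eqxx.
by case: ifP => _; rewrite inE ?eqxx ?orbT //; case/orP: IH => ->; rewrite ?orbT.
Qed.

Lemma alpha_avoid (X : seq V) :
  (forall (t : term Sg V) e, {in fv_term t, forall x, alpha_var e x (alpha_image e x)} ->
     exists t', alpha_term e t t' /\ {in bv_term t', forall z, z \notin X}) /\
  (forall (A : form Sg V) e, {in fv_form A, forall x, alpha_var e x (alpha_image e x)} ->
     exists A', alpha_form e A A' /\ {in bv_form A', forall z, z \notin X}).
Proof.
have bind x A e : (forall e, {in fv_form A, forall x, alpha_var e x (alpha_image e x)} ->
     exists A', @alpha_form Sg V e A A' /\ {in bv_form A', forall z, z \notin X}) ->
   {in [seq z <- fv_form A | z != x], forall x, alpha_var e x (alpha_image e x)} ->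
   exists y A', alpha_form ((x, y) :: e) A A' /\ {in y :: bv_form A', forall z, z \notin X}.
  (* The image of a free variable is either that variable or lies in [unzip2 e], so a binder [y]
     outside both [unzip2 e] and [fv_form A] captures none of them. *)
  move=> IH H; have [y] := infV (X ++ unzip2 e ++ fv_form A).
  rewrite !mem_cat !negb_or => /and3P[yX ye yA].
  have [|A' [AA' bA']] := IH ((x, y) :: e).
    move=> z zA /=; case: (z =P x) => [_|/eqP zx]; first by rewrite eqxx.
    rewrite H ?mem_filter ?zx // andbT; apply/eqP => zy.
    case/orP: (mem_alpha_image e z); rewrite zy; last by rewrite (negPf ye).
    by move=> /eqP yz; rewrite yz zA in yA.
  by exists y, A'; split=> // z; rewrite inE => /orP[/eqP->|/bA'].
have cat2 (P : V -> Prop) (s s' : seq V) : {in s ++ s', forall z, P z} ->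
    {in s, forall z, P z} /\ {in s', forall z, P z}.
  by move=> H; split=> z zs; apply: H; rewrite mem_cat zs ?orbT.
have catX (s s' : seq V) : {in s, forall z, z \notin X} -> {in s', forall z, z \notin X} ->
    {in s ++ s', forall z, z \notin X}.
  by move=> H H' z; rewrite mem_cat => /orP[/H|/H'].
apply: term_form_mutind => /=.
- by move=> x e H; exists (TVar (alpha_image e x)); split=> //; constructor; apply: H; rewrite inE.
- move=> x A IH e /(bind _ _ _ IH)[y [A' [AA' bA']]].
  by exists (Iota y A'); split=> //; constructor.
- move=> P xs e H; exists (Atom P (map_tuple (alpha_image e) xs)); split=> //.
  by constructor=> i; rewrite tnth_map; apply: H; apply: mem_tnth.
- move=> x y e H; exists (Equ (alpha_image e x) (alpha_image e y)); split=> //.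
  by constructor; apply: H; rewrite !inE eqxx ?orbT.
- by move=> e _; exists Bot; split=> //; constructor.
- move=> A IHA C IHC e /cat2[/IHA[A' [AA' bA]] /IHC[C' [CC' bC]]].
  by exists (And A' C'); split; [constructor|apply: catX].
- move=> A IHA C IHC e /cat2[/IHA[A' [AA' bA]] /IHC[C' [CC' bC]]].
  by exists (Or A' C'); split; [constructor|apply: catX].
- move=> A IHA C IHC e /cat2[/IHA[A' [AA' bA]] /IHC[C' [CC' bC]]].
  by exists (Imp A' C'); split; [constructor|apply: catX].
- move=> x A IH e /(bind _ _ _ IH)[y [A' [AA' bA']]].
  by exists (All y A'); split=> //; constructor.
- move=> x A IH e /(bind _ _ _ IH)[y [A' [AA' bA']]].
  by exists (Ex y A'); split=> //; constructor.
- by move=> A IH e /IH[A' [AA' bA']]; exists (Box A'); split=> //; constructor.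
- by move=> A IH e /IH[A' [AA' bA']]; exists (Dia A'); split=> //; constructor.
- move=> x A IHA t IHt e /cat2[/(bind _ _ _ IHA)[y [A' [AA' bA']]] /IHt[t' [tt' bt']]].
  exists (Lam y A' t'); split; first by constructor.
  exact: (catX (y :: bv_form A')).
Qed.

Lemma mem_fv_alpha e :
  (forall t t' : term Sg V, alpha_term e t t' -> forall z, z \in fv_term t' ->
     exists2 x, x \in fv_term t & alpha_var e x z) /\
  (forall A A' : form Sg V, alpha_form e A A' -> forall z, z \in fv_form A' ->
     exists2 x, x \in fv_form A & alpha_var e x z).
Proof.
have bind e' x y (A A' : form Sg V) : (forall z, z \in fv_form A' ->
      exists2 u, u \in fv_form A & alpha_var ((x, y) :: e') u z) ->
    forall z, z \in [seq u <- fv_form A' | u != y] ->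
    exists2 u, u \in [seq u <- fv_form A | u != x] & alpha_var e' u z.
  move=> IH z; rewrite mem_filter => /andP[zy /IH[u uA /=]].
  rewrite (negPf zy) andbF /= => /andP[ux uz]; exists u => //; by rewrite mem_filter ux.
have catl e' (X Y X' Y' : seq V) :
    (forall z, z \in X' -> exists2 u, u \in X & alpha_var e' u z) ->
    (forall z, z \in Y' -> exists2 u, u \in Y & alpha_var e' u z) ->
    forall z, z \in X' ++ Y' -> exists2 u, u \in X ++ Y & alpha_var e' u z.
  move=> HX HY z; rewrite mem_cat => /orP[/HX|/HY] [u uX uz]; exists u => //;
  by rewrite mem_cat uX ?orbT.
move: e; apply: alpha_mutind => /=.
- by move=> e x y xy z; rewrite inE => /eqP->; exists x; rewrite ?inE.
- by move=> e x y A A' _; apply: bind.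
- move=> e P xs ys xys z /tnthP[i ->]; exists (tnth xs i) => //; exact: mem_tnth.
- move=> e x1 x2 y1 y2 e1 e2 z; rewrite !inE => /orP[] /eqP->.
    by exists x1; rewrite ?inE ?eqxx.
  by exists x2; rewrite ?inE ?eqxx ?orbT.
- by [].
- by move=> e A A' C C' _ IHA _ IHC; apply: catl.
- by move=> e A A' C C' _ IHA _ IHC; apply: catl.
- by move=> e A A' C C' _ IHA _ IHC; apply: catl.
- by move=> e x y A A' _; apply: bind.
- by move=> e x y A A' _; apply: bind.
- by [].
- by [].
- by move=> e x y A A' t t' _ IHA _ IHt; apply: catl => //; apply: bind.
Qed.

Lemma alpha_sexpr_avoid (X : seq V) (E : sexpr Sg V L) : exists E',
  [/\ alpha_sexpr E E', {subset fv_sexpr E' <= fv_sexpr E} &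
      {in bv_sexpr E', forall z, z \notin X}].
Proof.
case: E => [w A|t x w].
  have [|A' [AA' bA']] := (alpha_avoid X).2 A [::]; first by move=> x _ /=.
  exists (Lab w A'); split=> //; first by constructor.
  by move=> z /((mem_fv_alpha _).2 _ _ AA')[u uA /eqP<-].
have [|t' [tt' bt']] := (alpha_avoid X).1 t [::]; first by move=> y _ /=.
exists (Den t' x w); split=> //; first by constructor.
move=> z; rewrite /= !inE => /orP[->//|/((mem_fv_alpha _).1 _ _ tt')[u ut /eqP<-]].
by rewrite ut orbT.
Qed.

Lemma alpha_expr_avoid (X : seq V) (E : expr Sg V L) : exists E',
  [/\ alpha_expr E E', {subset fv_expr E' <= fv_expr E} &
      {in bv_expr E', forall z, z \notin X}].
Proof.
case: E => [E|x w|w v].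
- have [E' [EE' fE' bE']] := alpha_sexpr_avoid X E.
  by exists E'; split=> //; constructor.
- by exists (Dom x w); split=> //; constructor.
- by exists (Rel w v); split=> //; constructor.
Qed.

Lemma Forall2_avoid (T : Type) (R : T -> T -> Prop) (fv bv : T -> seq V) (X : seq V) :
  (forall a, exists a', [/\ R a a', {subset fv a' <= fv a} & {in bv a', forall z, z \notin X}]) ->
  forall s, exists s', [/\ List.Forall2 R s s',
    {subset flatten (map fv s') <= flatten (map fv s)} &
    {in flatten (map bv s'), forall z, z \notin X}].
Proof.
move=> H; elim=> [|a s [s' [ss' fs' bs']]]; first by exists [::]; split.
have [a' [aa' fa' ba']] := H a; exists (a' :: s'); split; first by constructor.
  by move=> z /=; rewrite !mem_cat => /orP[/fa'->|/fs'->]; rewrite ?orbT.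
by move=> z /=; rewrite mem_cat => /orP[/ba'|/bs'].
Qed.

Lemma alpha_seq_avoid (X : seq V) (S : sequent Sg V L) : exists S',
  [/\ alpha_seq S S', {subset fv_seq S' <= fv_seq S} & {in bv_seq S', forall z, z \notin X}].
Proof.
case: S => G D.
have [G' [GG' fG' bG']] := Forall2_avoid (alpha_expr_avoid X) G.
have [D' [DD' fD' bD']] := Forall2_avoid (alpha_sexpr_avoid X) D.
exists (G' ⇒ D'); split=> //.
  by move=> z; rewrite /fv_seq /= !mem_cat => /orP[/fG'->|/fD'->]; rewrite ?orbT.
by move=> z; rewrite /bv_seq /= !mem_cat => /orP[/bG'|/bD'].
Qed.

End Renaming.

(** * Completeness without cut, and the admissibility of cut *)

Lemma subset_flatten_map (T : Type) (K : eqType) (f : T -> seq K) (s : seq T) a :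
  List.In a s -> {subset f a <= flatten (map f s)}.
Proof.
elim: s => //= b s IH [->|/IH H] z za; rewrite mem_cat ?za //.
by rewrite (H z za) orbT.
Qed.

Section Completeness.
Context {Sg : signature} {V L : eqType}.
Hypotheses (infV : infinite V) (infL : infinite L).
Variable N : nlrule -> Prop.

Lemma derivable_complete (S : sequent Sg V L) :
  (forall (M : model Sg N) (s : V -> object M) (l : L -> world M), ~ refutes s l S) ->
  derivable N S.
Proof.
move=> validS; have [S' [SS' fS' bS']] := alpha_seq_avoid (L := L) infV (fv_seq S) S.
exists S'; split=> //; apply: NNPP => nd.
(* Both [hole] and the binders go into the reserve, so [hole] must avoid the free variables and [x0]
   the reserve. [x0] and [w0] make objects and worlds exist even if the sequent has no free variable
   or no label. *)
have [hole hole_f] := infV (fv_seq S').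
have [x0 x0f] := infV (hole :: bv_seq S').
have [w0 _] := infL [::].
pose xs := x0 :: fv_seq S'; pose ws := w0 :: labels_seq S'.
pose B := hole :: bv_seq S'.
pose T := State (ante S') (succ S') (ante S') (succ S') xs ws.
have okE E : List.In E (ante S') -> ok B xs ws E.
  move=> ES; apply: ok_intro => z /(subset_flatten_map ES) zE; rewrite inE mem_cat zE ?orbT //.
have okF F : List.In F (succ S') -> ok B xs ws (Sx F).
  move=> FS; apply: ok_intro => z zF; rewrite inE mem_cat.
  - by rewrite (subset_flatten_map (f := fv_sexpr) FS zF) !orbT.
  - by rewrite (subset_flatten_map (f := bv_sexpr) FS zF) !orbT.
  - by rewrite (subset_flatten_map (f := labels_sexpr) FS zF) !orbT.
have vT : valid N B T.
  split=> //=; try by [left|case: (S') nd].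
  move=> x; rewrite inE => /orP[/eqP->//|xf]; rewrite inE negb_or.
  apply/andP; split; first by apply: contra hole_f => /eqP <-.
  by apply/negP => /bS'; rewrite (fS' _ xf).
have [M [s [l]]] := valid_refutable infV infL (mem_head hole _) vT (mem_head x0 _) (mem_head w0 _).
by rewrite /=; case: (S') SS' => G D SS' H; apply: (validS M s l); apply (alpha_refutes s l SS').
Qed.

End Completeness.

Theorem mainTheorem3 (Sg : signature) (V L : eqType)
    (infV : infinite V) (infL : infinite L) (N : nlrule -> Prop) :
  (forall (G G' : seq (expr Sg V L)) (D D' : seq (sexpr Sg V L))
          (w : L) (A : form Sg V),
      derivable N (G ⇒ Lab w A :: D) ->
      derivable N (Sx (Lab w A) :: G' ⇒ D') ->
      derivable N (G' ++ G ⇒ D ++ D'))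
  /\
  (forall (G G' : seq (expr Sg V L)) (D D' : seq (sexpr Sg V L))
          (t : term Sg V) (x : V) (w : L),
      derivable N (G ⇒ Den t x w :: D) ->
      derivable N (Sx (Den t x w) :: G' ⇒ D') ->
      derivable N (G' ++ G ⇒ D ++ D')).
Proof.
(* Labelled formulas and denotation formulas are both [sexpr], so one argument covers the two cuts:
   the truth value of [F] decides which premiss a refutation of the conclusion would refute. *)
have cut (G G' : seq (expr Sg V L)) (D D' : seq (sexpr Sg V L)) (F : sexpr Sg V L) :
    derivable N (G ⇒ F :: D) -> derivable N (Sx F :: G' ⇒ D') -> derivable N (G' ++ G ⇒ D ++ D').
  move=> dl dr; apply: derivable_complete => // M s l [/= /all_prop_cat[HG' HG] /all_prop_cat[HD HD']].
  have [Fh|nF] := classic (sholds s l F).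
    by apply: (derivable_sound dr (s := s) (l := l)).
  by apply: (derivable_sound dl (s := s) (l := l)).
by split=> G G' D D' *; apply: cut; eassumption.
Qed.
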